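(* For a transcendental number $\xi\in\mathbb{R}$ the exponents $\widehat{\lambda}_3(\xi)$ and $\omega_1(\xi)$ satisfy $$2\widehat{\lambda}_3(\xi)^3\omega_1(\xi)-\widehat{\lambda}_3(\xi)^2(\omega_1(\xi)-1)+2\widehat{\lambda}_3(\xi)\le 1.$$
   Context: $\widehat{\lambda}_3(\xi)$ is the supremum of all $\lambda$ such that for all sufficiently large $Q$ the system $\max_{1\le i\le 3}|x_0\xi^i-x_i|<Q^{-\lambda}$, $1\le|x_0|\le Q$ has a solution $(x_0,x_1,x_2,x_3)\in\mathbb{Z}^4$. $\omega_1(\xi)$ is the supremum of all $\omega$ such that $0<|P(\xi)|\le Q^{-\omega}$, $\deg P\le 1$, $H(P)\le Q$ has a solution $P\in\mathbb{Z}[x]$ for an unbounded sequence of values $Q$, where $H(P)$ is the maximum absolute value of the coefficients of $P$. *)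

(* Defs.v *)
From HB Require Import structures.
From mathcomp Require Import all_boot all_order all_algebra.
From mathcomp Require Import all_classical all_reals all_analysis.

Set Implicit Arguments.
Unset Strict Implicit.
Unset Printing Implicit Defensive.

Import Order.TTheory GRing.Theory Num.Theory.
Import numFieldNormedType.Exports.

Local Open Scope classical_set_scope.
Local Open Scope ring_scope.

Definition transcendental (R : realType) (xi : R) : Prop :=
  ~ algebraicOver (ratr : rat -> R) xi.

Definition height (P : {poly int}) : nat := \max_(i < size P) absz (P`_i)%R.

(* Both exponents are suprema in \bar R, since omega n xi may be +oo. *)

Definition lambda_hat (R : realType) (n : nat) (xi : R) : \bar R :=
  ereal_sup [set l%:E | l in [set l : R |
    \forall Q \near +oo, exists x : 'I_n.+1 -> int,
      1 <= `|(x ord0)%:~R : R| <= Q /\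
      \big[Order.max/0]_(i < n.+1 | (0 < i)%N)
         `|(x ord0)%:~R * xi ^+ i - (x i)%:~R| < Q `^ (- l)]].

(* size P <= n.+1 encodes deg P <= n. *)
Definition omega (R : realType) (n : nat) (xi : R) : \bar R :=
  ereal_sup [set w%:E | w in [set w : R |
    forall M : R, exists Q : R, M <= Q /\
      exists P : {poly int},
        [/\ (size P <= n.+1)%N,
            (height P)%:R <= Q &
            0 < `|(map_poly intr P).[xi]| <= Q `^ (- w)]]].

(* Main.v *)
Require Import Defs.
From HB Require Import structures.
From mathcomp Require Import all_boot all_order all_algebra.
From mathcomp Require Import all_classical all_reals all_analysis.
From mathcomp Require Import perm ring lra zify.

Set Implicit Arguments.
Unset Strict Implicit.
Unset Printing Implicit Defensive.

Import Order.TTheory GRing.Theory Num.Theory.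
Import numFieldNormedType.Exports.

Local Open Scope classical_set_scope.
Local Open Scope ring_scope.

(* Let x_i be the minimal points of (1, xi, xi^2, xi^3), with first coordinates
   X_i and errors L_i, so that L_i << X_(i+1)^-l for every l < lambda_hat_3.
   The 2 x 2 minors of the Hankel matrix with rows (y_0, y_1, y_2) and
   (y_1, y_2, y_3) of a point y with first coordinate Y and error L are the
   coefficients of a quadratic polynomial Q_y with H(Q_y) << Y L and
   Q_y(xi) << L^2.  Read as a linear form on polynomials of degree at most 3, a
   point z maps Q_y and T Q_y to a pair C(y, z) of integers whose quotient is
   close to xi, and C(y, z) = 0 iff Q_z is proportional to Q_y.

   Since the x_i lie in no hyperplane from some point on, there are arbitrarily
   large t < p such that x_t, x_p, x_(p+1), x_(p+2) are independent, while
   b = x_(t+1), b' = x_(t+2) span the same plane as c' = x_p, c = x_(p+1).  If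
   l^2 + 2 l > 1, then C(b, b') and C(c, c') do not vanish.  With
   d = x_(p+2) one gets
     X_d^(1-l) >> X_b^l X_c^l           from the determinant of the four points,
     X_d^l << X_c^(1-l)                 from |C(c, c')| >= 1,
     X_d^l << X_b X_c^(-l+(1-2l)w)      from the approximation C(b, b') of xi,
   for every w > omega_1, and eliminating X_b and X_d gives
   l^2 + 2 l - 1 <= l^2 (1 - 2 l) w, which is the theorem. *)

(** * Hankel matrices of integer points *)

(** The linear form sending [T^j] to [y j], evaluated at [T^k q] with [q] read as a quadratic
    polynomial. Only [k = 0, 1] stay within the four coordinates of a point. *)
Definition pairing (q y : nat -> int) (k : nat) : int :=
  q 0%N * y k + q 1%N * y k.+1 + q 2%N * y k.+2.

(** The cross product of the two rows of the Hankel matrix, hence orthogonal to both. *)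
Definition hankel (x : nat -> int) (k : nat) : int :=
  match k with
  | 0%N => x 1%N * x 3%N - x 2%N ^+ 2
  | 1%N => x 1%N * x 2%N - x 0%N * x 3%N
  | _ => x 0%N * x 2%N - x 1%N ^+ 2
  end.

Definition minor2 (x y : nat -> int) (j k : nat) : int := x j * y k - x k * y j.

Definition annihilates (q x : nat -> int) := pairing q x 0 = 0 /\ pairing q x 1 = 0.

Definition trivial3 (q : nat -> int) := [/\ q 0%N = 0, q 1%N = 0 & q 2%N = 0].

Lemma hankel_annihilates x : annihilates (hankel x) x.
Proof. by split; rewrite /pairing /hankel; ring. Qed.

Lemma lt3P (P : nat -> Prop) : P 0%N -> P 1%N -> P 2%N -> forall i, (i < 3)%N -> P i.
Proof. by move=> P0 P1 P2 [|[|[|i]]]. Qed.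

(* q is orthogonal to the rows r, r' of the Hankel matrix of x, hence
   q x (r x r') = r (q . r') - r' (q . r) = 0. *)
Lemma annihilates_prop q x : annihilates q x ->
  forall i j, (i < 3)%N -> (j < 3)%N -> q i * hankel x j = q j * hankel x i.
Proof.
move=> [h0 h1].
have c01 : q 0%N * hankel x 1 - q 1%N * hankel x 0 =
    x 2%N * pairing q x 1 - x 3%N * pairing q x 0.
  by rewrite /pairing /hankel; ring.
have c02 : q 0%N * hankel x 2 - q 2%N * hankel x 0 =
    x 2%N * pairing q x 0 - x 1%N * pairing q x 1.
  by rewrite /pairing /hankel; ring.
have c12 : q 1%N * hankel x 2 - q 2%N * hankel x 1 =
    x 0%N * pairing q x 1 - x 1%N * pairing q x 0.
  by rewrite /pairing /hankel; ring.
rewrite h0 h1 !mulr0 subrr in c01 c02 c12.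
move/subr0_eq: c01 => c01; move/subr0_eq: c02 => c02; move/subr0_eq: c12 => c12.
by move=> i j; move: i; apply: lt3P; move: j; apply: lt3P.
Qed.

(** Primitivity of [q] is kept as a Bezout relation with witness [u], the form in which
    [plucker_rank1] uses it. *)
Lemma primitive_part (Q : nat -> int) : ~ trivial3 Q ->
  exists q u : nat -> int, exists g : int,
    [/\ g != 0, forall i, (i < 3)%N -> Q i = g * q i &
        u 0%N * q 0%N + u 1%N * q 1%N + u 2%N * q 2%N = 1].
Proof.
move=> nz; pose h := gcdz (Q 0%N) (Q 1%N); pose g := gcdz h (Q 2%N).
have dh : (g %| h)%Z by rewrite dvdz_gcdl.
have dg : forall i, (i < 3)%N -> (g %| Q i)%Z.
  apply: lt3P; last exact: dvdz_gcdr.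
  - exact: dvdz_trans dh (dvdz_gcdl _ _).
  - exact: dvdz_trans dh (dvdz_gcdr _ _).
have g0 : g != 0.
  apply/eqP => g0; apply: nz.
  by split; apply/eqP; rewrite -dvd0z -g0; apply: dg.
have [u [v uv]] := Bezoutz (Q 0%N) (Q 1%N).
have [u' [v' uv']] := Bezoutz h (Q 2%N).
exists (fun i => (Q i %/ g)%Z).
exists (fun i => match i with 0%N => u' * u | 1%N => u' * v | _ => v' end), g.
have Qg i : (i < 3)%N -> Q i = g * (Q i %/ g)%Z.
  by move=> /dg d; rewrite mulrC divzK.
split=> //; apply: (mulfI g0); rewrite mulr1 !mulrDr !(mulrCA g) -!Qg // -!mulrA -mulrDr uv.
exact: uv'.
Qed.

(* The 2 x 2 minors of x and y, laid out so that they are proportional to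
   the products q_i q_j as soon as q annihilates x and y. *)
Definition plucker (x y : nat -> int) (i j : nat) : int :=
  match (i + j)%N, i with
  | 0%N, _ => minor2 x y 2 3
  | 1%N, _ => - minor2 x y 1 3
  | 2%N, 1%N => minor2 x y 0 3 + minor2 x y 1 2
  | 2%N, _ => minor2 x y 1 2
  | 3%N, _ => - minor2 x y 0 2
  | _, _ => minor2 x y 0 1
  end.

Lemma pluckerC x y i j : (i < 3)%N -> (j < 3)%N -> plucker x y i j = plucker x y j i.
Proof. by move: i; apply: lt3P; move: j; apply: lt3P. Qed.

(** Contracting the minors with [q] ([e0]) or with its shift [T q] ([e1]) gives zero, since both
    kill [x] and [y]; the claim is a linear consequence. This is the duality between the minors of
    two points of a plane and the complementary minors of its equations [q], [T q]. *)
Lemma plucker_prop q x y : annihilates q x -> annihilates q y ->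
  forall i j k, (i < 3)%N -> (j < 3)%N -> (k < 3)%N ->
  q i * plucker x y j k = q j * plucker x y i k.
Proof.
move=> [x0 x1] [y0 y1].
have e0 k : q 0%N * minor2 x y 0 k + q 1%N * minor2 x y 1 k + q 2%N * minor2 x y 2 k = 0.
  transitivity (y k * pairing q x 0 - x k * pairing q y 0).
    by rewrite /minor2 /pairing; ring.
  by rewrite x0 y0 !mulr0 subrr.
have e1 k : q 0%N * minor2 x y 1 k + q 1%N * minor2 x y 2 k + q 2%N * minor2 x y 3 k = 0.
  transitivity (y k * pairing q x 1 - x k * pairing q y 1).
    by rewrite /minor2 /pairing; ring.
  by rewrite x1 y1 !mulr0 subrr.
move: (e0 0%N) (e0 1%N) (e0 2%N) (e0 3%N) (e1 0%N) (e1 1%N) (e1 2%N) (e1 3%N).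
rewrite /minor2 => a0 a1 a2 a3 b0 b1 b2 b3.
move=> i j k; move: i; apply: lt3P; move: j; apply: lt3P; move: k; apply: lt3P;
  rewrite /plucker /minor2 /=; lra.
Qed.

(** Contracting [plucker_prop] with the Bezout vector [u] pulls one factor [q j] out of the matrix,
    and by symmetry a second contraction pulls out the other. The factor [s] is an integer because
    [u] is integral. *)
Lemma plucker_rank1 q u x y : annihilates q x -> annihilates q y ->
  u 0%N * q 0%N + u 1%N * q 1%N + u 2%N * q 2%N = 1 ->
  exists s : int, forall i j, (i < 3)%N -> (j < 3)%N ->
    plucker x y i j = s * (q i * q j).
Proof.
move=> qx qy uq; have prop := plucker_prop qx qy.
pose S k := u 0%N * plucker x y 0 k + u 1%N * plucker x y 1 k + u 2%N * plucker x y 2 k.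
have PS j k : (j < 3)%N -> (k < 3)%N -> plucker x y j k = q j * S k.
  move=> hj hk; rewrite /S !mulrDr !(mulrCA (q j)).
  rewrite -(prop 0%N j) // -(prop 1%N j) // -(prop 2%N j) //.
  by rewrite !mulrA -!mulrDl uq mul1r.
pose s := u 0%N * S 0%N + u 1%N * S 1%N + u 2%N * S 2%N.
have Ss k : (k < 3)%N -> S k = s * q k.
  move=> hk; rewrite /s !mulrDl -!mulrA !(mulrC (S _)) -!PS //.
  by rewrite !(pluckerC _ _ hk).
by exists s => i j hi hj; rewrite PS // Ss // mulrCA.
Qed.

Lemma minor2_plucker x y :
  [/\ minor2 x y 0 1 = plucker x y 2 2, minor2 x y 0 2 = - plucker x y 1 2
    & minor2 x y 0 3 = plucker x y 1 1 - plucker x y 0 2] /\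
  [/\ minor2 x y 1 2 = plucker x y 0 2, minor2 x y 1 3 = - plucker x y 0 1
    & minor2 x y 2 3 = plucker x y 0 0].
Proof. by rewrite /plucker /= !opprK; do 2!split=> //; rewrite addrK. Qed.

Lemma annihilates_comb q x y z (m u v : int) : m != 0 ->
  (forall j, (j < 4)%N -> m * z j = u * x j + v * y j) ->
  annihilates q x -> annihilates q y -> annihilates q z.
Proof.
move=> m0 zE [x0 x1] [y0 y1]; split; apply: (mulfI m0); rewrite mulr0.
  transitivity (u * pairing q x 0 + v * pairing q y 0); last first.
    by rewrite x0 y0 !mulr0 addr0.
  by rewrite /pairing !mulrDr !(mulrCA m) !zE //; ring.
transitivity (u * pairing q x 1 + v * pairing q y 1); last first.
  by rewrite x1 y1 !mulr0 addr0.
by rewrite /pairing !mulrDr !(mulrCA m) !zE //; ring.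
Qed.

Lemma dvdz_minor2 (s : int) x y :
  (forall i j, (i < 3)%N -> (j < 3)%N -> (s %| plucker x y i j)%Z) ->
  forall j k, (j < 4)%N -> (k < 4)%N -> (s %| minor2 x y j k)%Z.
Proof.
move=> dv; have [[m01 m02 m03] [m12 m13 m23]] := minor2_plucker x y.
have d01 : (s %| minor2 x y 0 1)%Z by rewrite m01 dv.
have d02 : (s %| minor2 x y 0 2)%Z by rewrite m02 rpredN dv.
have d03 : (s %| minor2 x y 0 3)%Z by rewrite m03 rpredB ?dv.
have d12 : (s %| minor2 x y 1 2)%Z by rewrite m12 dv.
have d13 : (s %| minor2 x y 1 3)%Z by rewrite m13 rpredN dv.
have d23 : (s %| minor2 x y 2 3)%Z by rewrite m23 dv.
have dC a b : (s %| minor2 x y a b)%Z -> (s %| minor2 x y b a)%Z.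
  by move=> ab; rewrite /minor2 -opprB rpredN.
have dA a : (s %| minor2 x y a a)%Z by rewrite /minor2 mulrC subrr dvdz0.
by move=> [|[|[|[|//]]]] [|[|[|[|//]]]] _ _; first [exact: dA | assumption | exact: dC].
Qed.

(** * Estimates *)

Section Estimates.
Context {R : realType} (xi : R).

Definition err (x : nat -> int) (j : nat) : R := (x j)%:~R - (x 0%N)%:~R * xi ^+ j.

Definition errs_le (x : nat -> int) (L : R) := forall j, (j < 4)%N -> `|err x j| <= L.

Definition coefs_le (q : nat -> int) (h : R) := forall i, (i < 3)%N -> `|(q i)%:~R : R| <= h.

Definition eval2 (q : nat -> int) : R :=
  (q 0%N)%:~R + (q 1%N)%:~R * xi + (q 2%N)%:~R * xi ^+ 2.

(** A single constant, at least 1, that bounds every [|xi^j|] with [j <= 3]; all implied constants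
    below are numerals times powers of it. *)
Definition Mx : R := (1 + `|xi|) ^+ 3.

Lemma normD_le (a b A B : R) : `|a| <= A -> `|b| <= B -> `|a + b| <= A + B.
Proof. by move=> ha hb; apply: le_trans (ler_normD _ _) _; apply: lerD. Qed.

Lemma normB_le (a b A B : R) : `|a| <= A -> `|b| <= B -> `|a - b| <= A + B.
Proof. by move=> ha hb; apply: normD_le; rewrite ?normrN. Qed.

Lemma normM_le (a b A B : R) : `|a| <= A -> `|b| <= B -> `|a * b| <= A * B.
Proof. by move=> ha hb; rewrite normrM; apply: ler_pM. Qed.

Ltac norm_bound :=
  repeat first [assumption | apply: normB_le | apply: normD_le | apply: normM_le].

Lemma xi_le_Mx j : (j < 4)%N -> `|xi ^+ j| <= Mx.
Proof.
move=> hj; rewrite normrX /Mx; apply: (@le_trans _ _ ((1 + `|xi|) ^+ j)).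
  by apply: lerXn2r; rewrite ?nnegrE ?addr_ge0 // lerDr.
by apply: ler_weXn2l; [rewrite lerDl | rewrite -ltnS].
Qed.

Lemma Mx_ge1 : 1 <= Mx.
Proof. by have := xi_le_Mx (isT : (0 < 4)%N); rewrite expr0 normr1. Qed.

Lemma Mx_gt0 : 0 < Mx. Proof. exact: lt_le_trans Mx_ge1. Qed.

Lemma coordE x j : (x j)%:~R = (x 0%N)%:~R * xi ^+ j + err x j.
Proof. by rewrite /err addrC subrK. Qed.

Lemma errs_le_ge0 x L : errs_le x L -> 0 <= L.
Proof. by move=> /(_ 0%N isT); apply: le_trans. Qed.

Lemma coefs_le_ge0 q h : coefs_le q h -> 0 <= h.
Proof. by move=> /(_ 0%N isT); apply: le_trans. Qed.

Lemma pairingE q y k :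
  (pairing q y k)%:~R = (y 0%N)%:~R * xi ^+ k * eval2 q + ((q 0%N)%:~R * err y k +
    (q 1%N)%:~R * err y k.+1 + (q 2%N)%:~R * err y k.+2).
Proof.
rewrite /pairing !intrD !intrM (coordE y k) (coordE y k.+1) (coordE y k.+2) /eval2.
by rewrite !exprS; ring.
Qed.

Lemma pairing_bound q y h L k : coefs_le q h -> errs_le y L -> (k < 2)%N ->
  `|(pairing q y k)%:~R| <= Mx * (`|(y 0%N)%:~R| * `|eval2 q|) + 3 * (h * L).
Proof.
move=> hq hy hk; rewrite pairingE; apply: normD_le.
  rewrite [_ * xi ^+ k]mulrC -mulrA -normrM; apply: normM_le => //.
  by apply: xi_le_Mx; exact: leq_trans hk _.
have -> : 3 * (h * L) = h * L + h * L + h * L by ring.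
by do 2?apply: normD_le; apply: normM_le; rewrite ?hq //; apply: hy; lia.
Qed.

(** When the pairing vanishes, the main term in [pairingE] is minus the error terms. *)
Lemma eval2_bound q x h L : coefs_le q h -> errs_le x L -> pairing q x 0 = 0 ->
  `|(x 0%N)%:~R| * `|eval2 q| <= 3 * (h * L).
Proof.
move=> hq hx /(congr1 (fun z : int => z%:~R : R)); rewrite pairingE expr0 mulr1.
move/eqP; rewrite addr_eq0 -normrM => /eqP ->; rewrite normrN.
have -> : 3 * (h * L) = h * L + h * L + h * L by ring.
by do 2?apply: normD_le; apply: normM_le; rewrite ?hq //; apply: hx.
Qed.

(** The main terms of the two pairings differ exactly by the factor [xi], so they cancel. *)
Lemma pairing_approx q y h L : coefs_le q h -> errs_le y L ->
  `|(pairing q y 1)%:~R - xi * (pairing q y 0)%:~R| <= 6 * (Mx * (h * L)).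
Proof.
move=> hq hy; have h0 := coefs_le_ge0 hq; have L0 := errs_le_ge0 hy.
have M1 := Mx_ge1.
have Mxi : `|xi| <= Mx by have := @xi_le_Mx 1; rewrite expr1; apply.
have hL : 0 <= h * L by apply: mulr_ge0.
rewrite !pairingE expr0 expr1.
set S1 := _ + _ + _; set S0 := (X in _ - xi * (_ + X)).
have -> : (y 0)%:~R * xi * eval2 q + S1 - xi * ((y 0)%:~R * 1 * eval2 q + S0) = S1 - xi * S0.
  by ring.
apply: le_trans (@normB_le _ _ (3 * (h * L)) (Mx * (3 * (h * L))) _ _) _.
- have -> : 3 * (h * L) = h * L + h * L + h * L by ring.
  by do 2?apply: normD_le; apply: normM_le; rewrite ?hq //; apply: hy.
- apply: normM_le => //.
  have -> : 3 * (h * L) = h * L + h * L + h * L by ring.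
  by do 2?apply: normD_le; apply: normM_le; rewrite ?hq //; apply: hy.
- nra.
Qed.

(** The terms in [X^2] cancel because the Hankel matrix of the powers of [xi] has rank one. At most
    six products remain, and [L * L <= X * L]. *)
Lemma hankel_bound x L : errs_le x L -> L <= 1 -> 1 <= `|(x 0%N)%:~R : R| ->
  coefs_le (hankel x) (6 * (Mx * (`|(x 0%N)%:~R| * L))).
Proof.
move=> hx L1 x1; have L0 := errs_le_ge0 hx.
have M1 := Mx_ge1; set X := (x 0%N)%:~R : R.
have e1 := hx 1%N isT; have e2 := hx 2%N isT; have e3 := hx 3%N isT.
have m1 := @xi_le_Mx 1 isT; have m2 := @xi_le_Mx 2 isT; have m3 := @xi_le_Mx 3 isT.
have a1 : `|X| <= `|X| by [].
have XL : L <= `|X| * L by rewrite ler_peMl.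
have LL : L * L <= `|X| * L by apply: ler_wpM2r => //; exact: le_trans x1.
have LM : `|X| * L <= Mx * (`|X| * L) by rewrite ler_peMl // mulr_ge0.
apply: lt3P; rewrite /hankel ?rmorphXn ?intrB ?rmorphXn ?intrM ?rmorphXn /=.
- have -> : (x 1)%:~R * (x 3)%:~R - (x 2)%:~R ^+ 2 =
     xi ^+ 1 * (X * err x 3) + xi ^+ 3 * (X * err x 1) + err x 1 * err x 3
     - xi ^+ 2 * (X * err x 2) - xi ^+ 2 * (X * err x 2) - err x 2 * err x 2.
    by rewrite !(coordE x 1, coordE x 2, coordE x 3) -/X; ring.
  apply: (@le_trans _ _ (Mx * (`|X| * L) + Mx * (`|X| * L) + L * L + Mx * (`|X| * L)
    + Mx * (`|X| * L) + L * L)); last lra.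
  by norm_bound.
- have -> : (x 1)%:~R * (x 2)%:~R - X * (x 3)%:~R =
     xi ^+ 1 * (X * err x 2) + xi ^+ 2 * (X * err x 1) + err x 1 * err x 2 - X * err x 3.
    by rewrite !(coordE x 1, coordE x 2, coordE x 3) -/X; ring.
  apply: (@le_trans _ _ (Mx * (`|X| * L) + Mx * (`|X| * L) + L * L + `|X| * L)); last lra.
  by norm_bound.
- have -> : X * (x 2)%:~R - (x 1)%:~R ^+ 2 =
     X * err x 2 - xi ^+ 1 * (X * err x 1) - xi ^+ 1 * (X * err x 1) - err x 1 * err x 1.
    by rewrite !(coordE x 1, coordE x 2, coordE x 3) -/X; ring.
  apply: (@le_trans _ _ (`|X| * L + Mx * (`|X| * L) + Mx * (`|X| * L) + L * L)); last lra.
  by norm_bound.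
Qed.

Lemma minor2_bound x y L Y j k : errs_le x L -> errs_le y L -> L <= 1 -> 1 <= Y ->
  `|(x 0%N)%:~R| <= Y -> `|(y 0%N)%:~R| <= Y -> (j < 4)%N -> (k < 4)%N ->
  `|(minor2 x y j k)%:~R| <= 6 * (Mx * (Y * L)).
Proof.
move=> hx hy L1 Y1 xY yY hj hk; have L0 := errs_le_ge0 hx; have M1 := Mx_ge1.
have ex1 := hx _ hj; have ex2 := hx _ hk; have ey1 := hy _ hj; have ey2 := hy _ hk.
have m1 := xi_le_Mx hj; have m2 := xi_le_Mx hk.
have LL : L * L <= Y * L by apply: ler_wpM2r => //; exact: le_trans Y1.
have LM : Y * L <= Mx * (Y * L) by rewrite ler_peMl // mulr_ge0 // (le_trans _ Y1).
rewrite /minor2 intrB !intrM.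
rewrite (coordE x j) (coordE y k) (coordE x k) (coordE y j).
set X := (x 0%N)%:~R : R in xY *; set Z := (y 0%N)%:~R : R in yY *.
have -> : (X * xi ^+ j + err x j) * (Z * xi ^+ k + err y k) -
    (X * xi ^+ k + err x k) * (Z * xi ^+ j + err y j) =
  xi ^+ j * (X * err y k) - xi ^+ k * (X * err y j) + xi ^+ k * (Z * err x j)
  - xi ^+ j * (Z * err x k) + err x j * err y k - err x k * err y j by ring.
apply: (@le_trans _ _ (Mx * (Y * L) + Mx * (Y * L) + Mx * (Y * L) + Mx * (Y * L)
   + L * L + L * L)); last lra.
by norm_bound.
Qed.

Lemma minor2_lower x y L L' j : `|err x j| = L -> `|err y j| <= L' ->
  `|(y 0%N)%:~R| * L - `|(x 0%N)%:~R| * L' <= `|(minor2 x y 0 j)%:~R : R|.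
Proof.
move=> xj yj; rewrite /minor2 intrB !intrM (coordE x j) (coordE y j).
set X := (x 0%N)%:~R : R; set Y := (y 0%N)%:~R : R.
have -> : X * (Y * xi ^+ j + err y j) - (X * xi ^+ j + err x j) * Y =
  X * err y j - Y * err x j by ring.
rewrite distrC; apply: le_trans (lerB_dist _ _); rewrite !normrM xj lerD2l lerN2.
exact: ler_wpM2l.
Qed.

End Estimates.

(** * Independent quadruples and determinants *)

Section Quadruple.
Context {F : fieldType}.

Lemma exists_annihilator n m (A : 'M[F]_(m, n)) : (\rank A < n)%N ->
  exists2 r : 'cV[F]_n, r != 0 & A *m r = 0.
Proof.
move=> rA; have : kermx A^T != 0 by rewrite kermx_eq0 -row_leq_rank mxrank_tr -ltnNge.
case/rowV0Pn => r /sub_kermxP rk r0; exists r^T; first by rewrite -trmx0 (inj_eq trmx_inj).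
by apply: trmx_inj; rewrite trmx_mul trmxK rk trmx0.
Qed.

Lemma rank2_free m (x y : 'rV[F]_m) (a b : F) : \rank (x + y)%MS = 2%N ->
  a *: x + b *: y = 0 -> a = 0.
Proof.
move=> r2 ab; apply/eqP/negPn/negP => a0.
have xy : (x <= y)%MS.
  move/eqP: ab; rewrite addr_eq0 => /eqP /(congr1 ( *:%R a^-1)).
  by rewrite scalerA mulVf // scale1r => ->; rewrite scalemx_sub // eqmx_opp scalemx_sub.
have /mxrankS : (x + y <= y)%MS by rewrite addsmx_sub xy submx_refl.
by rewrite r2 leqNgt ltnS rank_leq_row.
Qed.

Variable v : nat -> 'rV[F]_4.
Hypothesis rank2 : forall i, \rank (v i + v i.+1)%MS = 2%N.
Hypothesis unbounded : forall N (r : 'cV[F]_4), r != 0 ->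
  exists2 k, (N <= k)%N & v k *m r != 0.

Local Notation P p := (v p + v p.+1)%MS.

Let sub_mid m p : (v p <= P m)%MS -> (v p.+1 <= P m)%MS -> (P m <= P p)%MS.
Proof.
move=> h h'; have h2 : (P p <= P m)%MS by rewrite addsmx_sub h h'.
by have := mxrank_leqif_sup h2; case=> _ <-; rewrite !rank2.
Qed.

(** Let [v m.+2] be the first vector to leave the plane [P N]. If [v m] were in [P m.+1], equality
    of ranks would give [P m.+1 = P m], which is still inside [P N]. *)
Let exists_turn N : exists2 m, (N <= m)%N & ~~ (v m <= P m.+1)%MS.
Proof.
have [|r r0 Pr] := @exists_annihilator _ _ (P N); first by rewrite rank2.
have ex : exists k, (N <= k)%N && ~~ (v k <= P N)%MS.
  have [k Nk kr] := unbounded N r0; exists k; rewrite Nk.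
  by apply: contra kr => /submxP[D ->]; rewrite -mulmxA Pr mulmx0.
case: (ex_minnP ex) => k /andP[Nk kP] kmin.
have below j : (N <= j)%N -> (j < k)%N -> (v j <= P N)%MS.
  move=> Nj; apply: contraLR => jP; rewrite -leqNgt.
  by apply: kmin; rewrite Nj jP.
have kN : k != N by apply: contraNneq kP => ->; exact: addsmxSl.
have kN1 : k != N.+1 by apply: contraNneq kP => ->; exact: addsmxSr.
have [m km] : exists m, k = m.+2 by exists (k - 2)%N; lia.
rewrite {}km in kP kmin below Nk kN kN1 *.
have Nm : (N <= m)%N by lia.
exists m => //; apply: contra kP => mP.
apply: submx_trans (addsmxSr (v m.+1) _) _.
have h : (P m <= P m.+1)%MS by rewrite addsmx_sub mP addsmxSl.
have [_] := mxrank_leqif_sup h; rewrite !rank2 eqxx => /esym h'.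
by apply: submx_trans h' _; rewrite addsmx_sub !below //; lia.
Qed.

(** Start from three consecutive independent vectors at [m], and let [r] define a hyperplane through
    them. Take [p.+2] as the first later index off this hyperplane, and [t] as the last index up to
    [p.+1] with [v t] outside [P p]; it exists since the three vectors at [m] do not all lie in
    [P p]. Then [v t.+1] and [v t.+2] lie in [P p] and span it. *)
Lemma exists_quadruple N : exists t p : nat,
  [/\ (N <= t)%N, (t < p)%N, (P t.+1 <= P p)%MS, (P p <= P t.+1)%MS &
   \det (\matrix_(i < 4) v (nth 0%N [:: t; p; p.+1; p.+2] i)) != 0].
Proof.
have [m Nm mP] := exists_turn N.
have [|r r0] := @exists_annihilator _ _ (v m + P m.+1)%MS.
  apply: leq_ltn_trans (mxrank_adds_leqif _ _) _; rewrite rank2.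
  by rewrite -[4%N]/(1 + 2).+1 ltnS leq_add2r rank_leq_row.
move=> kill; have killed w : (w <= v m + P m.+1)%MS -> w *m r = 0.
  by move=> /submxP[D ->]; rewrite -mulmxA kill mulmx0.
have ex : exists k, (m <= k)%N && (v k *m r != 0).
  by have [k ? ?] := unbounded m r0; exists k; apply/andP.
case: (ex_minnP ex) => k /andP[mk kr] kmin.
have below j : (m <= j)%N -> (j < k)%N -> v j *m r = 0.
  move=> mj; apply: contraTeq => jr; rewrite -leqNgt.
  by apply: kmin; rewrite mj jr.
have m0 : v m *m r = 0 by apply: killed; exact: addsmxSl.
have m1 : v m.+1 *m r = 0.
  by apply: killed; apply: submx_trans (addsmxSr _ _); exact: addsmxSl.
have m2 : v m.+2 *m r = 0.
  by apply: killed; apply: submx_trans (addsmxSr _ _); exact: addsmxSr.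
have {m0}k0 : k != m by apply: contraNneq kr => ->; apply/eqP.
have {m1}k1 : k != m.+1 by apply: contraNneq kr => ->; apply/eqP.
have {m2}k2 : k != m.+2 by apply: contraNneq kr => ->; apply/eqP.
have [p kp] : exists p, k = p.+2 by exists (k - 2)%N; lia.
rewrite {}kp in kr kmin below mk k0 k1 k2 *.
have ext : exists t, [&& (m <= t)%N, (t <= p.+1)%N & ~~ (v t <= P p)%MS].
  have [m0|m0] := boolP (v m <= P p)%MS;
    last by exists m; rewrite m0; apply/and3P; split=> //; lia.
  have [m1|m1] := boolP (v m.+1 <= P p)%MS;
    last by exists m.+1; rewrite m1; apply/and3P; split=> //; lia.
  exists m.+2; apply/and3P; split; [lia|lia|]; apply: contra mP => m2.
  exact: submx_trans m0 (sub_mid m1 m2).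
have bnd t : [&& (m <= t)%N, (t <= p.+1)%N & ~~ (v t <= P p)%MS] -> (t <= p.+1)%N by case/and3P.
case: (ex_maxnP ext bnd) => t /and3P[mt tp tP] tmax.
have above j : (t < j)%N -> (j <= p.+1)%N -> (v j <= P p)%MS.
  move=> tj jp; apply: contraLR (tj) => jP; rewrite -leqNgt; apply: tmax.
  by rewrite jP jp !andbT; lia.
have {bnd ext tmax}tp' : (t < p)%N.
  have tnp : t != p by apply: contraNneq tP => ->; exact: addsmxSl.
  have tnp1 : t != p.+1 by apply: contraNneq tP => ->; exact: addsmxSr.
  by lia.
have t1 : (v t.+1 <= P p)%MS by apply: above; lia.
have t2 : (v t.+2 <= P p)%MS by apply: above; lia.
exists t, p; split; [lia | by [] | by rewrite addsmx_sub t1 | exact: sub_mid |].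
(* In a linear relation [u], applying [r] kills the last coefficient, [v t] outside [P p] kills the
   first, and the rank of [P p] kills the other two. *)
apply/det0P => -[u u0 uA]; case/negP: u0.
move: uA; rewrite mulmx_sum_row !big_ord_recl big_ord0 addr0 !rowK /=.
set i1 := lift _ _; set i2 := lift _ _; set i3 := lift _ _ => uA.
have u3 : u 0 i3 = 0.
  apply/eqP; move/(congr1 (mulmx^~ r)): uA.
  rewrite !mulmxDl -!scalemxAl mul0mx !(below t, below p, below p.+1); try lia.
  rewrite !scaler0 !add0r => /eqP; case/boolP: (u 0 i3 == 0) => // u3.
  by rewrite scaler_eq0 (negPf u3) (negPf kr).
rewrite u3 scale0r addr0 in uA.
have uu : u 0 ord0 = 0.
  apply/eqP/negPn/negP => un; case/negP: tP.
  move/eqP: uA; rewrite addr_eq0 => /eqP /(congr1 ( *:%R (u 0 ord0)^-1)).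
  rewrite scalerA mulVf // scale1r => ->.
  by apply/scalemx_sub; rewrite eqmx_opp addmx_sub_adds // scalemx_sub.
rewrite uu scale0r add0r in uA.
have u1 := rank2_free (rank2 p) uA.
have u2 : u 0 i2 = 0.
  by apply: (@rank2_free _ (v p.+1) (v p) _ (u 0 i1)); rewrite 1?addsmxC // addrC.
apply/eqP/rowP => -[[|[|[|[|//]]]] hi]; rewrite mxE.
- by rewrite -[RHS]uu; congr (u 0 _); exact: val_inj.
- by rewrite -[RHS]u1; congr (u 0 _); exact: val_inj.
- by rewrite -[RHS]u2; congr (u 0 _); exact: val_inj.
- by rewrite -[RHS]u3; congr (u 0 _); exact: val_inj.
Qed.

End Quadruple.

Section DetBound.
Context {R : realType} (xi : R).

(** Subtracting [xi^j] times column 0 from column [j] is undone by the unipotent matrix [T]. *)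
Lemma det_errors (A E : 'M[R]_4) : (forall i, E i ord0 = A i ord0) ->
  (forall i j, j != ord0 -> E i j = A i j - A i ord0 * xi ^+ j) -> \det A = \det E.
Proof.
move=> E0 Ej.
pose T : 'M[R]_4 := \matrix_(i, j) if i == j then 1 else if i == ord0 then xi ^+ j else 0.
have -> : A = E *m T.
  apply/matrixP => i j; rewrite mxE.
  have [->|j0] := eqVneq j ord0.
    rewrite (bigD1 ord0) //= big1 ?addr0 ?mxE ?eqxx ?mulr1 ?E0 // => k k0.
    by rewrite mxE (negPf k0) mulr0.
  rewrite (bigD1 ord0) //= (bigD1 j) //= big1 ?addr0; last first.
    by move=> k /andP[k0 kj]; rewrite mxE (negPf k0) (negPf kj) mulr0.
  by rewrite !mxE eq_sym (negPf j0) !eqxx mulr1 E0 Ej // addrC subrK.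
rewrite det_mulmx -[X in _ = X]mulr1; congr (_ * _).
rewrite -det_tr det_trig; last first.
  apply/is_trig_mxP => i j ij; rewrite !mxE.
  have /negPf -> : j != i by rewrite neq_ltn ij orbT.
  have /negPf -> // : j != ord0 by rewrite -lt0n; apply: leq_ltn_trans ij.
by rewrite big1 // => i _; rewrite !mxE eqxx.
Qed.

(** Each of the [24 = 4!] Leibniz products has one factor from column 0, in row [z]. Since
    [X z <= X 3] and [L 3 <= L z], the worst case is [z = 3]. *)
Lemma det4_bound (E : 'M[R]_4) (X L : nat -> R) :
  (forall i : 'I_4, `|E i ord0| <= X i) ->
  (forall i j : 'I_4, j != ord0 -> `|E i j| <= L i) ->
  (forall i, (i < 4)%N -> 0 <= X i <= X 3%N) -> (forall i, (i < 4)%N -> 0 <= L 3%N <= L i) ->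
  `|\det E| <= 24 * (X 3%N * L 0%N * L 1%N * L 2%N).
Proof.
move=> EX EL XX LL; rewrite /determinant.
set B := X 3%N * _ * _ * _.
have main (s : 'S_4) : `|(-1) ^+ s * \prod_i E i (s i)| <= B.
  rewrite normrM normrX normrN1 expr1n mul1r normr_prod.
  set z := (s^-1)%g ord0.
  apply: (@le_trans _ _ (\prod_(i < 4) (if i == z then X i else L i))).
    apply: ler_prod => i _; rewrite normr_ge0 /=; case: eqP => [->|/eqP iz].
      by rewrite permKV.
    by apply: EL; apply: contra iz => /eqP h; rewrite -(permK s i) h.
  have := XX 0%N isT; have := XX 1%N isT; have := XX 2%N isT; have := XX 3%N isT.
  have := LL 0%N isT; have := LL 1%N isT; have := LL 2%N isT.
  move=> /andP[l3 l2] /andP[_ l1] /andP[_ l0] /andP[x3 _] /andP[x2 x23] /andP[x1 x13] /andP[x0 x03].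
  rewrite !big_ord_recl big_ord0 mulr1 /= /B.
  have l0' := le_trans l3 l0; have l1' := le_trans l3 l1; have l2' := le_trans l3 l2.
  case: z => -[|[|[|[|//]]]] hz; rewrite -!val_eqE /=.
  - rewrite [X 3%N * _ * _ * _](_ : _ = X 3%N * (L 1%N * (L 2%N * L 0%N))); last by ring.
    by do 3?[apply: ler_pM; rewrite ?mulr_ge0 //].
  - rewrite [X 3%N * _ * _ * _](_ : _ = L 0%N * (X 3%N * (L 2%N * L 1%N))); last by ring.
    by do 3?[apply: ler_pM; rewrite ?mulr_ge0 //].
  - rewrite [X 3%N * _ * _ * _](_ : _ = L 0%N * (L 1%N * (X 3%N * L 2%N))); last by ring.
    by do 3?[apply: ler_pM; rewrite ?mulr_ge0 //].
  - rewrite [X 3%N * _ * _ * _](_ : _ = L 0%N * (L 1%N * (L 2%N * X 3%N))); last by ring.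
    by do 3?[apply: ler_pM; rewrite ?mulr_ge0 //].
apply: le_trans (ler_norm_sum _ _ _) _.
apply: (@le_trans _ _ (\sum_(s : 'S_4) B)); first exact: ler_sum.
by rewrite sumr_const card_Sn mulr_natl.
Qed.

End DetBound.

(** * Minimal points *)

Section MinimalPoints.
Context {R : realType} (xi : R).

(** The maximal error is expressed by a bound together with an index attaining it. Points with first
    coordinate 0 are outside [mp_min]; their errors are integers, so [mp_L_lt1] deals with them. *)
Record minimal_points (x : nat -> nat -> int) (L : nat -> R) : Prop := MinimalPoints {
  mp_gt0 : forall i, 0 < x i 0%N;
  mp_incr : forall i, x i 0%N < x i.+1 0%N;
  mp_errs : forall i, errs_le xi (x i) (L i);
  mp_attained : forall i, exists2 j, (j < 4)%N & `|err xi (x i) j| = L i;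
  mp_L_gt0 : forall i, 0 < L i;
  mp_L_lt1 : forall i, L i < 1;
  mp_decr : forall i, L i.+1 < L i;
  mp_min : forall i (z : nat -> int), z 0%N != 0 -> `|z 0%N| < x i.+1 0%N ->
    exists2 j, (j < 4)%N & L i <= `|err xi z j| }.

Lemma transcendental_free (c : nat -> rat) : transcendental xi ->
  \sum_(j < 4) ratr (c j) * xi ^+ j = 0 -> forall j, (j < 4)%N -> c j = 0.
Proof.
move=> hxi c0 j hj; apply: contrapT => /eqP cj; apply: hxi.
exists (\poly_(i < 4) c i).
  by apply: contraNneq cj => /(congr1 (fun p : {poly rat} => p`_j));
    rewrite coef_poly hj coef0 => ->.
rewrite /root (@horner_coef_wide _ 4).
  under eq_bigr => i _ do rewrite coef_map coef_poly ltn_ord /=.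
  by rewrite c0.
by apply: leq_trans (size_poly _ _) _; exact: size_poly.
Qed.

Hypothesis hxi : transcendental xi.

Lemma transcendental_irrational (a b : int) : a%:~R + b%:~R * xi = 0 -> a = 0 /\ b = 0.
Proof.
move=> ab; pose c j : rat := match j with 0%N => a%:~R | 1%N => b%:~R | _ => 0 end.
have cz : \sum_(j < 4) ratr (c j) * xi ^+ j = 0.
  by rewrite !big_ord_recl big_ord0 /= !ratr_int !raddf0 !mul0r !addr0 expr0 expr1 mulr1.
have := transcendental_free hxi cz; move=> h.
by split; apply/eqP; rewrite -(intr_eq0 rat); apply/eqP; [exact: (h 0%N)|exact: (h 1%N)].
Qed.

Definition round (a : R) : int := Num.floor (a + 2^-1).

Lemma round_le a : `|(round a)%:~R - a| <= 2^-1.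
Proof.
rewrite /round; have := floor_itv (a + 2^-1); rewrite intrD => /andP[].
move: (Num.floor _)%:~R => z h1 h2; rewrite ler_norml; apply/andP; lra.
Qed.

Lemma round_min a (m : int) : `|(round a)%:~R - a| <= `|m%:~R - a|.
Proof.
have [->//|nm] := eqVneq m (round a).
apply: le_trans (round_le a) _.
have h : 1 <= `|m%:~R - (round a)%:~R : R|.
  by rewrite -intrB -intr_norm ler1z; lia.
have := round_le a; have := ler_distD a (m%:~R : R) (round a)%:~R.
rewrite [`|a - _|]distrC; lra.
Qed.

Definition pt (q : nat) (j : nat) : int := round (q%:R * xi ^+ j).

Definition dist (q : nat) : R :=
  Num.max `|err xi (pt q) 1| (Num.max `|err xi (pt q) 2| `|err xi (pt q) 3|).

Lemma pt0 q : pt q 0 = q.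
Proof.
rewrite /pt expr0 mulr1; apply/eqP; rewrite /round floor_eq.
by rewrite intrD pmulrn; apply/andP; lra.
Qed.

Lemma err_pt q j : err xi (pt q) j = (round (q%:R * xi ^+ j))%:~R - q%:R * xi ^+ j.
Proof. by rewrite /err pt0 pmulrn. Qed.

Lemma err0 (z : nat -> int) : err xi z 0 = 0.
Proof. by rewrite /err expr0 mulr1 subrr. Qed.

Lemma dist_le q : errs_le xi (pt q) (dist q).
Proof.
move=> [|[|[|[|//]]]] _; rewrite ?err0 ?normr0 /dist !le_max ?lexx ?orbT //.
by rewrite normr_ge0.
Qed.

Lemma dist_half q : dist q <= 2^-1.
Proof. by rewrite /dist !ge_max !err_pt !round_le. Qed.

Lemma dist_attained q : exists2 j, (0 < j < 4)%N & `|err xi (pt q) j| = dist q.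
Proof.
rewrite /dist; case: leP => _; last by exists 1%N.
by case: leP => _; [exists 3%N | exists 2%N].
Qed.

Lemma dist_min q (z : nat -> int) (B : R) : (0 < q)%N -> `|z 0%N| = q ->
  (forall j, (0 < j < 4)%N -> `|err xi z j| < B) -> dist q < B.
Proof.
move=> q0 zq zB; have [j hj <-] := dist_attained q; apply: le_lt_trans (zB j hj).
rewrite err_pt; have [z0|z0] := leP 0 (z 0%N).
  have zE : z 0%N = q by rewrite -zq ger0_norm.
  by rewrite /err zE -pmulrn; exact: round_min.
have zE : z 0%N = - q%:Z by rewrite -zq ltr0_norm // opprK.
rewrite /err zE intrN -pmulrn mulNr opprK -[leRHS]normrN opprD -intrN.
exact: round_min.
Qed.

Lemma dist_gt0 q : (0 < q)%N -> 0 < dist q.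
Proof.
move=> q0; have := dist_le q (isT : (1 < 4)%N); apply: lt_le_trans.
rewrite normr_gt0 /err pt0 expr1; apply/eqP => /eqP; rewrite addrC -mulNr -intrN => /eqP.
rewrite addrC => /transcendental_irrational[_]; lia.
Qed.

(** The condition on [l] inside [lambda_hat 3], with the neighbourhood of [+oo] unfolded to an
    explicit threshold. *)
Definition uniform (l : R) := exists M : R, forall Q, M < Q -> exists x : 'I_4 -> int,
  1 <= `|(x ord0)%:~R : R| <= Q /\
  \big[Order.max/0]_(i < 4 | (0 < i)%N) `|(x ord0)%:~R * xi ^+ i - (x i)%:~R| < Q `^ (- l).

Lemma uniform_dist l : uniform l -> exists M : R, forall Q, M < Q ->
  exists q : nat, [/\ (0 < q)%N, q%:R <= Q & dist q < Q `^ (- l)].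
Proof.
move=> [M hM]; exists M => Q /hM[x [/andP[x1 xQ] xl]].
pose z j := x (inord j).
have z0 : z 0%N = x ord0 by rewrite /z; congr x; apply: val_inj; rewrite /= inordK.
have xE : `|(x ord0)%:~R : R| = `|x ord0|%N%:R.
  by rewrite -intr_norm -abszE pmulrn.
exists `|x ord0|%N; rewrite -xE; split=> //.
  by rewrite -(ltr_nat R) -xE; lra.
apply: (@dist_min _ z); rewrite ?z0 ?abszE //.
  by rewrite -(ltr_nat R) -xE; lra.
move=> j /andP[j0 j4]; apply: le_lt_trans xl.
have jo : (inord j : 'I_4) = j :> nat by rewrite inordK.
rewrite /err z0 distrC /z -{1}jo.
by rewrite (le_bigmax_cond _ (fun i : 'I_4 => `|(x ord0)%:~R * xi ^+ i - (x i)%:~R|)) // jo.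
Qed.

Lemma exists_minimal_points l : 0 < l -> uniform l -> exists x L k,
  minimal_points x L /\ forall i, ln (L i) <= k - l * ln (x i.+1 0%N)%:~R.
Proof.
move=> l0 /uniform_dist[M hM].
have better q : exists q', (0 < q)%N -> (0 < q')%N && (dist q' < dist q).
  have [q0|//] := ltnP 0 q; last by exists 0%N.
  (* The second term ensures [Q^(-l) <= dist q]. *)
  pose Q := Num.max (M + 1) (expR (- ln (dist q) / l)).
  have [|q' [q'0 _ q'd]] := hM Q; first by rewrite lt_max ltrDl ltr01.
  exists q' => _; rewrite q'0 /=; apply: lt_le_trans q'd _.
  have Q0 : 0 < Q by rewrite lt_max expR_gt0 orbT.
  rewrite -ler_ln ?posrE ?powR_gt0 ?dist_gt0 // ln_powR.
  have : - ln (dist q) / l <= ln Q.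
    by rewrite -[leLHS]expRK ler_ln ?posrE ?expR_gt0 // le_max lexx orbT.
  by rewrite ler_pdivrMr // => h; lra.
have next q : exists q', (0 < q)%N -> [/\ (0 < q')%N, dist q' < dist q &
    forall q'', (0 < q'')%N -> (q'' < q')%N -> dist q <= dist q''].
  have [q0|//] := ltnP 0 q; last by exists 0%N.
  have ex : exists q', (0 < q')%N && (dist q' < dist q).
    by have [q' h] := better q; exists q'; exact: h.
  case: (ex_minnP ex) => q' /andP[? ?] qmin; exists q' => _; split=> // q'' q''0 lt.
  by rewrite leNgt; apply/negP => h; move: lt; rewrite ltnNge qmin // q''0.
have {next}[f hf] := choice next.
pose s i := iter i f 1%N.
have s0 i : (0 < s i)%N by elim: i => // i ih; have [] := hf _ ih.
have hs i : [/\ (0 < s i.+1)%N, dist (s i.+1) < dist (s i) &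
    forall q, (0 < q)%N -> (q < s i.+1)%N -> dist (s i) <= dist q] := hf _ (s0 i).
have incr i : (s i < s i.+1)%N.
  have [_ d1 _] := hs i; rewrite ltnNge leq_eqVlt; apply/negP => /orP[/eqP h|h].
    by rewrite h ltxx in d1.
  case: i d1 h => [|i] d1 h; first by have := s0 1%N; rewrite lt0n -leqn0 -ltnS h.
  have [_ d2 /(_ _ (s0 i.+2) h)] := hs i.
  by rewrite leNgt (lt_trans d1 d2).
(* The uniform condition is applied at half of the next first coordinate: the point it yields then
   lies strictly below the next minimal point, so minimality applies. The halving costs the constant
   [l * ln 2], and the first [N] points are dropped to pass the threshold. *)
have [N hN] : exists N, forall i, (N <= i)%N -> M < (s i)%:R / 2.
  exists (Num.bound `|2 * M|) => i iN.
  have : (i < s i)%N by elim: (i) => // j ih; exact: leq_ltn_trans ih (incr j).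
  move=> /(leq_ltn_trans iN); rewrite -(ltr_nat R) => h.
  have := archi_boundP (normr_ge0 (2 * M)); have := ler_norm (2 * M); lra.
exists (fun i => pt (s (i + N)%N)), (fun i => dist (s (i + N)%N)), (l * ln 2).
split; last first.
  move=> i; rewrite pt0 addSn -pmulrn.
  set q := s (i + N)%N; set q' := s (i + N).+1.
  have q'0 : 0 < q'%:R :> R by rewrite ltr0n; exact: s0.
  have [p [p0 pq pd]] := hM _ (hN (i + N).+1 (leqW (leq_addl _ _))).
  have pq' : (p < q')%N.
    by rewrite -(ltr_nat R); apply: le_lt_trans pq _; rewrite -/q'; lra.
  have [_ _ /(_ p p0 pq')] := hs (i + N)%N; rewrite -/q => qp.
  have /ltW := le_lt_trans qp pd.
  rewrite -ler_ln ?posrE ?dist_gt0 ?s0 ?powR_gt0 // ?divr_gt0 // ln_powR -/q'.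
  by rewrite ln_div ?posrE // => h; lra.
split.
- by move=> i; rewrite pt0; exact: s0.
- by move=> i; rewrite !pt0 addSn; have := incr (i + N)%N.
- by move=> i; exact: dist_le.
- by move=> i; have [j /andP[_ j4] jE] := dist_attained (s (i + N)%N); exists j.
- by move=> i; exact: dist_gt0.
- by move=> i; apply: le_lt_trans (dist_half _) _; lra.
- by move=> i; rewrite addSn; have [] := hs (i + N)%N.
- move=> i z z0; rewrite pt0 addSn => zlt; apply: contrapT => nz.
  have zq : (0 < `|z 0%N|)%N by rewrite absz_gt0.
  have [_ _ /(_ `|z 0%N|%N zq)] := hs (i + N)%N.
  have lt : (`|z 0%N| < s (i + N).+1)%N by rewrite -ltz_nat abszE.
  move=> /(_ lt); apply/negP; rewrite -ltNge; apply: (@dist_min _ z) => //.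
  by move=> j /andP[_ j4]; rewrite ltNge; apply/negP => h; apply: nz; exists j.
Qed.

End MinimalPoints.

Lemma intr_norm_ge1 (R : realType) (z : int) : z != 0 -> 1 <= `|z%:~R : R|.
Proof. by move=> z0; rewrite -intr_norm ler1z; lia. Qed.

Lemma ln_le_prod2 (R : realType) (K a b : R) : 0 < K -> 0 < a -> 0 < b ->
  1 <= K * (a * b) -> 0 <= ln K + ln a + ln b.
Proof. by move=> K0 a0 b0 /ln_ge0; rewrite !lnM ?posrE ?mulr_gt0 // addrA. Qed.

Lemma ln_le_prod3 (R : realType) (K a b c : R) : 0 < K -> 0 < a -> 0 < b -> 0 < c ->
  1 <= K * (a * b * c) -> 0 <= ln K + ln a + ln b + ln c.
Proof. by move=> K0 a0 b0 c0 /ln_ge0; rewrite !lnM ?posrE ?mulr_gt0 // !addrA. Qed.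

(** * Growth, minors and saturation of the minimal points *)

Section Quantitative.
Context {R : realType} (xi : R) (x : nat -> nat -> int) (L : nat -> R).
Hypothesis mp : minimal_points xi x L.

Local Notation X i := ((x i 0%N)%:~R : R).
Local Notation M := (Mx xi).

Lemma X_gt i : i%:R < X i.
Proof.
have : (i%:Z < x i 0%N) by elim: i => [|i ih]; [exact: mp_gt0 mp 0%N|have := mp_incr mp i; lia].
by rewrite -(ltr_int R) pmulrn.
Qed.

Lemma X_gt0 i : 0 < X i. Proof. by rewrite ltr0z (mp_gt0 mp). Qed.

Lemma X_ge1 i : 1 <= X i.
Proof. by rewrite ler1z; have := mp_gt0 mp i; lia. Qed.

Lemma X_norm i : `|X i| = X i. Proof. by rewrite ger0_norm // ltW // X_gt0. Qed.

Lemma X_mono : {homo (fun i => X i) : i j / (i < j)%N >-> i < j}.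
Proof. by apply: homo_ltn; [exact: lt_trans | move=> i; rewrite ltr_int; exact: mp_incr mp i]. Qed.

Lemma L_mono : {homo L : i j / (i < j)%N >-> j < i}.
Proof. by apply: homo_ltn => [a b c ab bc|i]; [exact: lt_trans bc ab | exact: mp_decr mp i]. Qed.

Lemma L_gt0 i : 0 < L i. Proof. exact: mp_L_gt0 mp i. Qed.

Lemma ln_X_large (A : R) : exists N, forall i, (N <= i)%N -> A < ln (X i).
Proof.
exists (Num.bound (expR A)) => i Ni.
rewrite -[ltLHS]expRK ltr_ln ?posrE ?expR_gt0 ?X_gt0 //.
apply: lt_trans (archi_boundP (ltW (expR_gt0 A))) _.
by apply: le_lt_trans (X_gt i); rewrite ler_nat.
Qed.

Lemma minor2_min_lower i k : (i < k)%N -> exists2 j, (j < 4)%N &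
  X k * L i - X i * L k <= `|(minor2 (x i) (x k) 0 j)%:~R : R|.
Proof.
move=> ik; have [j j4 jE] := mp_attained mp i; exists j => //.
by rewrite -{1}(X_norm k) -{1}(X_norm i); apply: minor2_lower jE _; exact: mp_errs mp k j j4.
Qed.

Lemma minor2_neq0 i k : (i < k)%N -> exists2 j, (j < 4)%N & minor2 (x i) (x k) 0 j != 0.
Proof.
move=> ik; have [j j4 jE] := minor2_min_lower ik; exists j => //.
have := X_mono ik; have := L_mono ik; have := L_gt0 k; have := X_gt0 i => x0 l0 h1 h2.
have : 0 < X k * L i - X i * L k.
  by rewrite subr_gt0; apply: ltr_pM => //; exact: ltW.
by move=> /lt_le_trans /(_ jE); rewrite normr_gt0 intr_eq0.
Qed.

(** The factor 2 makes the subtracted term of [minor2_min_lower] at most half of the main term. *)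
Lemma minor2_lower_half i k : (i < k)%N -> 2 * X i <= X k -> exists2 j, (j < 4)%N &
  X k * L i <= 2 * `|(minor2 (x i) (x k) 0 j)%:~R : R|.
Proof.
move=> ik x2; have [j j4 jE] := minor2_min_lower ik; exists j => //.
have := L_mono ik; have := L_gt0 k; have := X_gt0 i => x0 l0 h1; nra.
Qed.

Lemma coefs_le_hankel i : coefs_le (hankel (x i)) (6 * (M * (X i * L i))).
Proof.
have := @hankel_bound _ xi (x i) (L i) (mp_errs mp i) (ltW (mp_L_lt1 mp i)).
by rewrite X_norm; apply; exact: X_ge1.
Qed.

(** The two rows of a Hankel matrix of rank one are proportional, and their first entries fix the
    ratio. *)
Lemma hankel_trivial_shift i : trivial3 (hankel (x i)) -> forall (a b : int),
  b * x i 0%N = a * x i 1%N -> forall j, (j < 3)%N -> b * x i j = a * x i j.+1.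
Proof.
move=> [/= h0 h1 h2] a b ab; have x0 : x i 0%N != 0 by have := mp_gt0 mp i; lia.
apply: lt3P => //; apply: (mulfI x0).
- have -> : x i 0%N * (b * x i 1%N) = x i 1%N * (b * x i 0%N) by ring.
  rewrite ab; have -> : x i 0%N * (a * x i 2%N) = a * (x i 0%N * x i 2%N) by ring.
  by rewrite (subr0_eq h2); ring.
- have -> : x i 0%N * (b * x i 2%N) = x i 2%N * (b * x i 0%N) by ring.
  rewrite ab; have -> : x i 0%N * (a * x i 3%N) = a * (x i 0%N * x i 3%N) by ring.
  by rewrite -(subr0_eq h1); ring.
Qed.

Lemma shift_hankel_trivial i (a b : int) : (a != 0) || (b != 0) ->
  (forall j, (j < 3)%N -> b * x i j = a * x i j.+1) -> trivial3 (hankel (x i)).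
Proof.
move=> ab h; have h0 := h 0%N isT; have h1 := h 1%N isT; have h2 := h 2%N isT.
have x0 : x i 0%N != 0 by have := mp_gt0 mp i; lia.
have a0 : a != 0.
  apply/eqP => a0; move: ab h0; rewrite a0 eqxx /= mul0r => b0 /eqP.
  by rewrite mulf_eq0 (negPf b0) (negPf x0).
split; apply: (mulfI a0); rewrite mulr0 /=.
- have -> : a * (x i 1%N * x i 3%N - x i 2%N ^+ 2) =
    x i 1%N * (a * x i 3%N) - x i 2%N * (a * x i 2%N) by ring.
  by rewrite -h2 -h1; ring.
- have -> : a * (x i 1%N * x i 2%N - x i 0%N * x i 3%N) =
    x i 2%N * (a * x i 1%N) - x i 0%N * (a * x i 3%N) by ring.
  by rewrite -h0 -h2; ring.
- have -> : a * (x i 0%N * x i 2%N - x i 1%N ^+ 2) =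
    x i 0%N * (a * x i 2%N) - x i 1%N * (a * x i 1%N) by ring.
  by rewrite -h0 -h1; ring.
Qed.

(** The linear form attached to [x i], evaluated at [T^j (b - a T)]: main term plus errors. *)
Lemma shift_bound i (a b : int) (B : R) j : (j < 3)%N ->
  `|a%:~R : R| <= B -> `|b%:~R : R| <= B ->
  `|(b * x i j - a * x i j.+1)%:~R : R| <=
  M * (X i * `|b%:~R - a%:~R * xi|) + 2 * (B * L i).
Proof.
move=> j3 aB bB; rewrite intrB !intrM (coordE xi (x i) j) (coordE xi (x i) j.+1).
have -> : b%:~R * (X i * xi ^+ j + err xi (x i) j) -
    a%:~R * (X i * xi ^+ j.+1 + err xi (x i) j.+1) =
   xi ^+ j * (X i * (b%:~R - a%:~R * xi)) + (b%:~R * err xi (x i) j - a%:~R * err xi (x i) j.+1).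
  by rewrite exprS; ring.
have e1 := mp_errs mp i (ltnW j3 : (j < 4)%N); have e2 := mp_errs mp i (j3 : (j.+1 < 4)%N).
have -> : 2 * (B * L i) = B * L i + B * L i by ring.
have m := @xi_le_Mx _ xi j (ltnW j3); have xx : `|X i| <= X i by rewrite X_norm.
have dd := lexx `|b%:~R - a%:~R * xi|.
by apply: normD_le; [do 2?apply: normM_le | apply: normB_le; apply: normM_le].
Qed.

(** Modulo [s] the combination of [x i.+1] and [x i] with coefficients [x i a] and [- x i.+1 a]
    vanishes. Replacing these coefficients by centred residues [r], [r'] and dividing by [s] gives
    an integer point [z] with first coordinate below that of [x i.+1] and errors below [L i].
    Minimality forces [z = 0], and independence of the two points gives [r = 0]. *)
Lemma saturated i (s : int) :
  (forall j k, (j < 4)%N -> (k < 4)%N -> (s %| minor2 (x i) (x i.+1) j k)%Z) ->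
  s != 0 -> forall a, (a < 4)%N -> (s %| x i a)%Z.
Proof.
move=> sdiv s0 a a4.
pose m c : int := round ((c%:~R : R) / s%:~R).
pose rho c := c - s * m c.
have s0R : 0 < `|s%:~R : R| by rewrite normr_gt0 intr_eq0.
have rho_le c : `|(rho c)%:~R : R| <= `|s%:~R| / 2.
  rewrite /rho intrB intrM.
  have -> : (c%:~R : R) - s%:~R * (m c)%:~R = - (s%:~R * ((m c)%:~R - c%:~R / s%:~R)).
    by rewrite mulrBr mulrCA mulfV ?mulr1 ?opprB // intr_eq0.
  rewrite normrN normrM; apply: ler_wpM2l => //; exact: round_le.
pose r := rho (x i a); pose r' := rho (x i.+1 a).
pose z k : int := (minor2 (x i) (x i.+1) a k %/ s)%Z -
  (m (x i a) * x i.+1 k - m (x i.+1 a) * x i k).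
have sz k : (k < 4)%N -> s * z k = r * x i.+1 k - r' * x i k.
  move=> k4; rewrite /z mulrBr mulrC divzK ?sdiv // /minor2 /r /r' /rho; ring.
have sz0 := sz 0%N isT.
have lt1 := X_mono (ltnSn i); have lt2 := L_mono (ltnSn i).
have half (u v U V : R) : `|u| <= U -> `|v| <= V ->
    `|r%:~R * u - r'%:~R * v| <= `|s%:~R| * ((U + V) / 2).
  move=> hu hv.
  have -> : `|s%:~R : R| * ((U + V) / 2) = `|s%:~R| / 2 * U + `|s%:~R| / 2 * V by ring.
  by apply: normB_le; apply: normM_le => //; exact: rho_le.
have zerr j : (j < 4)%N -> `|err xi z j| < L i.
  move=> j4; rewrite -(ltr_pM2l s0R) -normrM.
  have -> : s%:~R * err xi z j = r%:~R * err xi (x i.+1) j - r'%:~R * err xi (x i) j.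
    rewrite /err mulrBr !mulrA -!intrM sz // sz0 !intrB !intrM /r /r' /rho !intrB !intrM; ring.
  apply: le_lt_trans (half _ _ _ _ (mp_errs mp i.+1 j4) (mp_errs mp i j4)) _.
  by rewrite ltr_pM2l //; lra.
have z0 : z 0%N = 0.
  apply/eqP/negPn/negP => z0.
  have [|j j4] := @mp_min _ _ _ _ mp i z z0; last by rewrite leNgt zerr.
  rewrite -(ltr_int R) intr_norm -(ltr_pM2l s0R) -normrM -intrM sz0 intrB !intrM.
  apply: le_lt_trans (half _ _ (X i.+1) (X i) _ _) _; rewrite ?X_norm //.
  by rewrite ltr_pM2l //; lra.
have zj k : (k < 4)%N -> z k = 0.
  move=> k4; apply/eqP/negPn/negP => zk; have := zerr k k4.
  rewrite /err z0 mul0r subr0 ltNge; apply/negP/negPn.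
  by apply: le_trans (intr_norm_ge1 R zk); exact: ltW (mp_L_lt1 mp i).
have [j j4 mj] := minor2_neq0 (ltnSn i).
have r0 : r = 0.
  apply/eqP/negPn/negP => r0; case/negP: mj; rewrite -(mulrI_eq0 _ (mulfI r0)); apply/eqP.
  have -> : r * minor2 (x i) (x i.+1) 0 j =
    x i 0%N * (r * x i.+1 j - r' * x i j) - x i j * (r * x i.+1 0%N - r' * x i 0%N).
    by rewrite /minor2; ring.
  by rewrite -!sz // z0 zj // !mulr0 subrr.
by apply/dvdzP; exists (m (x i a)); rewrite mulrC; exact: subr0_eq r0.
Qed.

(** By [saturated], [x i.+1] is divisible by [s]; if [|s| >= 2] the quotient contradicts minimality.
    The indices start at [i.+1] because [mp_min] needs a predecessor. *)
Lemma primitive_pair i (s : int) : s != 0 ->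
  (forall j k, (j < 4)%N -> (k < 4)%N -> (s %| minor2 (x i.+1) (x i.+2) j k)%Z) ->
  `|s| = 1.
Proof.
move=> s0 sdiv; have dv := saturated sdiv s0.
apply: contrapT => s1; have s2 : 2 <= `|s| by lia.
pose z j := (x i.+1 j %/ s)%Z.
have zE j : (j < 4)%N -> s * z j = x i.+1 j by move=> /dv d; rewrite mulrC divzK.
have x0 := mp_gt0 mp i.+1; have z00 := zE 0%N isT.
have [| |j j4] := @mp_min _ _ _ _ mp i z.
- by apply/eqP => z0; move: x0; rewrite -z00 z0 mulr0 ltxx.
- have : `|s| * `|z 0%N| = x i.+1 0%N by rewrite -normrM z00 gtr0_norm.
  nia.
have s2R : 2 <= `|s%:~R : R| by rewrite -intr_norm (ler_int R 2).
have : `|s%:~R : R| * `|err xi z j| <= L i.+1.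
  rewrite -normrM /err mulrBr !mulrA -!intrM zE // z00; exact: mp_errs mp i.+1 j j4.
have := L_mono (ltnSn i); have := normr_ge0 (err xi z j); nra.
Qed.

End Quantitative.

(** * Linear algebra over the rationals and independence of minimal points *)

Definition rat_row (y : nat -> int) : 'rV[rat]_4 := \row_(j < 4) (y j)%:~R.

Lemma rat_row_comb (y z z' : nat -> int) : (rat_row y <= rat_row z + rat_row z')%MS ->
  exists m u w : int, m != 0 /\
    forall j, (j < 4)%N -> m * y j = u * z j + w * z' j.
Proof.
case/sub_addsmxP => -[u w] /= E; set a := u 0 0; set b := w 0 0.
exists (denq a * denq b), (numq a * denq b), (numq b * denq a).
split; first by rewrite mulf_neq0 // denq_neq0.
move=> j j4; apply: (@intr_inj rat); rewrite !rmorphD !rmorphM /=.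
move/rowP: E => /(_ (Ordinal j4)).
rewrite !mxE !big_ord_recl !big_ord0 !addr0 !mxE /= -/a -/b => ->.
by rewrite !numqE; ring.
Qed.

(** The forms [q] and [T q] vanish on the first three points, and some nonzero combination
    [(b - a T) q], with coefficient row [r b a], vanishes on the fourth as well. *)
Lemma annihilated_det (q : nat -> int) (y : nat -> nat -> int) : ~ trivial3 q ->
  (forall i, (i < 3)%N -> annihilates q (y i)) ->
  \det (\matrix_(i < 4) rat_row (y i)) = 0.
Proof.
move=> nz qy; apply/eqP; rewrite -det_tr; apply/det0P.
pose r (b a : int) : 'rV[rat]_4 := \row_(j < 4)
  (match j : nat with
   | 0%N => b * q 0%N | 1%N => b * q 1%N - a * q 0%N
   | 2%N => b * q 2%N - a * q 1%N | _ => - (a * q 2%N) end)%:~R.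
have rE b a : b * pairing q (y 3%N) 0 = a * pairing q (y 3%N) 1 ->
    r b a *m (\matrix_(i < 4) rat_row (y i))^T = 0.
  move=> ba; have {}ba i : (i < 4)%N -> b * pairing q (y i) 0 = a * pairing q (y i) 1.
    case: i => [|[|[|[|//]]]] // _.
    - by have [-> ->] := qy 0%N isT; rewrite !mulr0.
    - by have [-> ->] := qy 1%N isT; rewrite !mulr0.
    - by have [-> ->] := qy 2%N isT; rewrite !mulr0.
  apply/rowP => i; rewrite !mxE !big_ord_recl big_ord0 addr0 !mxE /= -!intrM -!intrD.
  have -> : (0 : rat) = (b * pairing q (y i) 0 - a * pairing q (y i) 1)%:~R.
    by rewrite ba ?subrr.
  by congr (_%:~R); rewrite /pairing; ring.
have [a0|a0] := eqVneq (pairing q (y 3%N) 0) 0.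
  exists (r 1 0); last by apply: rE; rewrite a0 mulr0 mul0r.
  apply/eqP => /rowP z; apply: nz.
  have := z (inord 0); have := z (inord 1); have := z (inord 2).
  rewrite !mxE !inordK // !mul0r !subr0 !mul1r => /eqP + /eqP + /eqP.
  by rewrite !intr_eq0 => /eqP ? /eqP ? /eqP ?.
exists (r (pairing q (y 3%N) 1) (pairing q (y 3%N) 0)); last by apply: rE; rewrite mulrC.
apply/eqP => /rowP z; apply: nz.
have := z (inord 1); have := z (inord 2); have := z (inord 3).
rewrite !mxE !inordK // => /eqP + /eqP + /eqP; rewrite !intr_eq0 oppr_eq0 mulf_eq0 (negPf a0) /=.
move=> /eqP q2; rewrite q2 mulr0 sub0r oppr_eq0 mulf_eq0 (negPf a0) /= => /eqP q1.
by rewrite q1 mulr0 sub0r oppr_eq0 mulf_eq0 (negPf a0) /= => /eqP q0.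
Qed.

Section Independence.
Context {R : realType} (xi : R) (x : nat -> nat -> int) (L : nat -> R).
Hypothesis mp : minimal_points xi x L.
Hypothesis hxi : transcendental xi.

Local Notation X i := ((x i 0%N)%:~R : R).
Local Notation M := (Mx xi).

Let M_gt0 : 0 < M. Proof. exact: Mx_gt0. Qed.
Let X0 i : 0 < X i. Proof. exact: X_gt0 mp i. Qed.
Let L0 i : 0 < L i. Proof. exact: L_gt0 mp i. Qed.
Let v i := rat_row (x i).

Lemma rank_consecutive i : \rank (v i + v i.+1)%MS = 2%N.
Proof.
have ub : (\rank (v i + v i.+1)%MS <= 2)%N.
  apply: leq_trans (mxrank_adds_leqif _ _) _.
  by rewrite -[2%N]/(1 + 1)%N leq_add // rank_leq_row.
apply/eqP; rewrite eqn_leq ub /=.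
have v0 : v i.+1 != 0.
  apply/eqP => /rowP /(_ ord0); rewrite !mxE /= => /eqP; rewrite intr_eq0.
  by have := mp_gt0 mp i.+1; lia.
have r1 : \rank (v i.+1) = 1%N by rewrite rank_rV v0.
rewrite -[Y in (Y < _)%N]r1; apply: rank_ltmx; rewrite ltmxE addsmxSr /=.
apply/negP => /(submx_trans (addsmxSl _ _)) /sub_rVP[c /rowP cE].
have [j j4 /negP[]] := minor2_neq0 mp (ltnSn i).
have := cE (Ordinal j4); have := cE ord0; rewrite !mxE /= => e0 ej.
rewrite -(intr_eq0 rat) /minor2 rmorphB !rmorphM /= e0 ej; apply/eqP; ring.
Qed.

(** A relation valid for all late points bounds [X i * |V|], where [V] is the same combination of
    the powers of [xi]. As [X i] is unbounded, [V = 0], contrary to transcendence. *)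
Lemma no_linear_relation N (r : 'cV[rat]_4) : r != 0 ->
  exists2 i, (N <= i)%N & v i *m r != 0.
Proof.
move=> r0; apply: contrapT => no; case/eqP: r0.
have kill i : (N <= i)%N -> \sum_(j < 4) (x i j)%:~R * r j 0 = 0.
  move=> Ni; apply: contrapT => /eqP h; apply: no; exists i => //.
  apply: contra h => /eqP /matrixP /(_ 0 0); rewrite !mxE => h.
  by apply/eqP; rewrite -[RHS]h; apply: eq_bigr => j _; rewrite mxE.
pose c j : rat := r (inord j) 0; pose S : R := \sum_(j < 4) `|ratr (c j)|.
pose V : R := \sum_(j < 4) ratr (c j) * xi ^+ j.
have VS i : (N <= i)%N -> X i * `|V| <= S.
  move=> /kill /(congr1 (ratr : rat -> R)); rewrite rmorph0 rmorph_sum /= => h.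
  have {h} : X i * V = - \sum_(j < 4) ratr (c j) * err xi (x i) j.
    apply/eqP; rewrite -addr_eq0 /V mulr_sumr -big_split /= -[Y in _ == Y]h; apply/eqP.
    apply: eq_bigr => j _; rewrite rmorphM /= ratr_int (coordE xi (x i) j) /c inord_val; ring.
  move/(congr1 Num.norm); rewrite normrM (X_norm mp) normrN => ->.
  apply: le_trans (ler_norm_sum _ _ _) _; apply: ler_sum => j _.
  rewrite normrM ler_piMr //; apply: le_trans (mp_errs mp i (ltn_ord j)) _.
  exact: ltW (mp_L_lt1 mp i).
have V0 : V = 0.
  apply: contrapT => /eqP; rewrite -normr_gt0 => V0.
  pose n := Num.bound (S / `|V|).
  have S0 : 0 <= S by apply: sumr_ge0.
  have := archi_boundP (divr_ge0 S0 (ltW V0)); rewrite -/n ltr_pdivrMr // => nb.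
  have := VS (maxn N n) (leq_maxl _ _); apply/negP; rewrite -ltNge.
  apply: lt_le_trans nb _; apply: ler_wpM2r => //.
  apply: le_trans (ltW (X_gt mp (maxn N n))); rewrite ler_nat; exact: leq_maxr.
have c0 := transcendental_free hxi V0.
apply/colP => j; rewrite mxE -(c0 j (ltn_ord j)) /c inord_val //.
Qed.

Lemma det_ge1 (y : nat -> nat) : \det (\matrix_(i < 4) v (y i)) != 0 ->
  (forall i, (i < 4)%N -> (y i <= y 3%N)%N) ->
  1 <= 24 * (X (y 3%N) * L (y 0%N) * L (y 1%N) * L (y 2%N)).
Proof.
move=> d0 y3.
pose A : 'M[int]_4 := \matrix_(i, j) x (y i) j.
have dA : \det A != 0.
  rewrite -(intr_eq0 rat) -det_map_mx; apply: contra d0 => /eqP <-; apply/eqP.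
  by congr (\det _); apply/matrixP => i j; rewrite !mxE.
apply: le_trans (intr_norm_ge1 R dA) _; rewrite -det_map_mx.
pose E : 'M[R]_4 := \matrix_(i, j) if j == ord0 then X (y i) else err xi (x (y i)) j.
rewrite (@det_errors _ xi _ E); first last.
- by move=> i j j0; rewrite !mxE (negPf j0).
- by move=> i; rewrite !mxE.
have le3 i : (i < 4)%N -> y i = y 3%N \/ (y i < y 3%N)%N.
  by move=> /y3; rewrite leq_eqVlt => /orP[/eqP|]; [left|right].
apply: (@det4_bound _ E (fun i => X (y i)) (fun i => L (y i))).
- by move=> i; rewrite mxE /= (X_norm mp).
- by move=> i j j0; rewrite mxE (negPf j0); exact: mp_errs mp (y i) j (ltn_ord j).
- move=> i /le3[->|h]; rewrite ?lexx ?(ltW (X0 _)) //=.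
  exact/ltW/(X_mono mp).
- move=> i /le3[->|h]; rewrite ?lexx ?(ltW (L0 _)) //=.
  exact/ltW/(L_mono mp).
Qed.

End Independence.

(** * Consequences of the uniform exponent *)

Lemma ln_prod3 (R : realType) (K a b c : R) : 0 < K -> 0 < a -> 0 < b -> 0 < c ->
  ln (K * (a * b * c)) = ln K + ln a + ln b + ln c.
Proof. by move=> *; rewrite !lnM ?posrE ?mulr_gt0 // !addrA. Qed.

(** [B], [C], [D] stand for the logarithms of [X_b], [X_c], [X_d]. The weights [l] and [1 - l]
    eliminate [D]. *)
Lemma log_gap (R : realFieldType) (l B C D K1 K4 : R) : 0 < l -> l < 1 / 2 ->
  l * B + l * C <= (1 - l) * D + K1 -> l * D <= (1 - l) * C + K4 ->
  l ^+ 2 * B <= (1 - 2 * l) * C + (l * K1 + (1 - l) * K4).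
Proof.
move=> l0 lhalf h1 h4; have p : 0 <= 1 - l by lra.
by have := ler_wpM2l (ltW l0) h1; have := ler_wpM2l p h4; lra.
Qed.

(** The same weights eliminate [D] from the first and third hypotheses; the weights [l^2] and
    [1 - l - l^2] then eliminate [B] against [log_gap]. *)
Lemma log_final (R : realFieldType) (l w B C D K1 K4 K5 : R) : 0 < l -> l < 1 / 2 ->
  l * B + l * C <= (1 - l) * D + K1 -> l * D <= (1 - l) * C + K4 ->
  l * D <= B - l * C + (1 - 2 * l) * w * C + K5 ->
  (1 - l) * (l ^+ 2 + 2 * l - 1 - l ^+ 2 * (1 - 2 * l) * w) * C <=
  (1 - l - l ^+ 2) * (l * K1 + (1 - l) * K4) + l ^+ 2 * (l * K1 + (1 - l) * K5).
Proof.
move=> l0 lhalf h1 h4 h5; have p : 0 <= 1 - l by lra.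
have p2 : 0 <= 1 - l - l ^+ 2 by nra.
have p3 : 0 <= l ^+ 2 by rewrite exprn_ge0 // ltW.
have a : (l - (1 - l) * (1 - 2 * l) * w) * C <= (1 - l - l ^+ 2) * B + (l * K1 + (1 - l) * K5).
  by have := ler_wpM2l (ltW l0) h1; have := ler_wpM2l p h5; lra.
have := ler_wpM2l p2 (log_gap l0 lhalf h1 h4).
by have := ler_wpM2l p3 a; lra.
Qed.

Lemma geometric_shift (y : nat -> int) (a b : int) :
  (forall j, (j < 3)%N -> b * y j = a * y j.+1) ->
  forall j, (j < 4)%N -> a ^+ j * y j = b ^+ j * y 0%N.
Proof.
move=> h; elim=> [|j ih] j4; first by rewrite !expr0.
by rewrite exprSr -mulrA -(h j j4) mulrCA ih 1?ltnW // mulrA -exprS.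
Qed.

Section Exponent.
Context {R : realType} (xi : R) (x : nat -> nat -> int) (L : nat -> R).
Hypothesis mp : minimal_points xi x L.
Hypothesis hxi : transcendental xi.
Variables l k : R.
Hypothesis Lk : forall i, ln (L i) <= k - l * ln (x i.+1 0%N)%:~R.

Local Notation X i := ((x i 0%N)%:~R : R).
Local Notation M := (Mx xi).
Local Notation v i := (rat_row (x i)).

Let M_gt0 : 0 < M. Proof. exact: Mx_gt0. Qed.
Let X0 i : 0 < X i. Proof. exact: X_gt0 mp i. Qed.
Let L0 i : 0 < L i. Proof. exact: L_gt0 mp i. Qed.

(* If the Hankel matrix of x_i has rank one, then x_i is a multiple of
   (a^3, a^2 b, a b^2, b^3), and a = O (X_i^(1/3)) is so small that x_(i-1)
   must be proportional to the same vector. *)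
Lemma hankel_nontrivial : 1 < 3 * l ->
  exists N, forall i, (N <= i)%N -> ~ trivial3 (hankel (x i)).
Proof.
move=> l3.
(* Beyond this threshold [5 M A L_i < 1] whenever [A^3 <= X i.+1]. *)
have [N hN] := ln_X_large mp (3 * (k + ln (5 * M)) / (3 * l - 1)).
exists N.+1 => -[//|i] Ni triv; move: {hN}(hN i.+1 (leqW Ni)).
have d0 : 0 < 3 * l - 1 by lra.
rewrite ltr_pdivrMr // => Xbig.
have x0 : x i.+1 0%N != 0 by have := mp_gt0 mp i.+1; lia.
pose g := gcdz (x i.+1 0%N) (x i.+1 1%N).
have g0 : g != 0 by rewrite gcdz_eq0 (negPf x0).
pose a := (x i.+1 0%N %/ g)%Z; pose b := (x i.+1 1%N %/ g)%Z.
have ag : x i.+1 0%N = a * g by rewrite divzK // dvdz_gcdl.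
have bg : x i.+1 1%N = b * g by rewrite divzK // dvdz_gcdr.
have ab : coprimez a b.
  have : gcdz (a * g) (b * g) = g by rewrite -ag -bg.
  rewrite -mulz_gcdl => h; rewrite /coprimez.
  have gp : `|g|%N = g :> int by rewrite gez0_abs // gcdz_ge0.
  by move: h; rewrite gp -[RHS]mul1r => /(mulIf g0) ->.
have shift := hankel_trivial_shift mp triv (_ : b * x i.+1 0%N = a * x i.+1 1%N).
have {}shift := shift (ltac:(rewrite ag bg; ring)).
have cube : a ^+ 3 * x i.+1 3%N = b ^+ 3 * x i.+1 0%N by exact: geometric_shift.
have a3 : (a ^+ 3 %| x i.+1 0%N)%Z.
  rewrite -(@Gauss_dvdzr _ (b ^+ 3)).
    by apply/dvdzP; exists (x i.+1 3%N); rewrite -cube mulrC.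
  by apply: coprimezXl; apply: coprimezXr.
have a0 : a != 0 by apply: contraNneq x0 => a0; rewrite ag a0 mul0r.
pose A := `|a%:~R : R|; have A1 : 1 <= A := intr_norm_ge1 R a0.
have A0 : 0 < A by lra.
have A3 : A ^+ 3 <= X i.+1.
  have [c cE] := dvdzP a3.
  have c0 : c != 0 by apply: contraNneq x0 => c0; rewrite cE c0 mul0r.
  rewrite -(X_norm mp) cE intrM normrM rmorphXn normrX ler_peMl ?exprn_ge0 ?(ltW A0) //.
  exact: intr_norm_ge1.
have lnA : 3 * ln A <= ln (X i.+1).
  by rewrite mulr_natl -lnXn // ler_ln ?posrE ?exprn_gt0.
pose G := `|g%:~R : R|; have G1 : 1 <= G := intr_norm_ge1 R g0.
have AG : X i.+1 = A * G by rewrite -(X_norm mp) ag intrM normrM.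
have M1 := Mx_ge1 xi.
have apx : G * `|b%:~R - a%:~R * xi| <= L i.+1.
  have := mp_errs mp i.+1 (isT : (1 < 4)%N).
  rewrite /err ag bg expr1 !intrM [b%:~R * _]mulrC [a%:~R * _]mulrC -mulrA -mulrBr.
  by rewrite normrM.
have Ldec := L_mono mp (ltnSn i); have Xinc := X_mono mp (ltnSn i).
have L1 := mp_L_lt1 mp i.+1.
have ap1 : `|b%:~R - a%:~R * xi| <= L i.+1.
  by apply: le_trans apx; rewrite ler_peMl.
have bA : `|b%:~R : R| <= 2 * (M * A).
  have -> : b%:~R = (b%:~R - a%:~R * xi) + a%:~R * xi by rewrite subrK.
  have -> : 2 * (M * A) = M * A + A * M by ring.
  apply: normD_le; first by apply: le_trans ap1 _; nra.
  by apply: normM_le => //; have := @xi_le_Mx _ xi 1; rewrite expr1; exact.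
have aA : `|a%:~R : R| <= 2 * (M * A) by rewrite -/A; nra.
have small j : (j < 3)%N -> b * x i j = a * x i j.+1.
  move=> j3; apply: subr0_eq; apply/eqP/negPn/negP => nz.
  have := le_trans (intr_norm_ge1 R nz) (shift_bound mp i j3 aA bA).
  have XA : X i * `|b%:~R - a%:~R * xi| <= A * L i.
    apply: (@le_trans _ _ (A * (G * `|b%:~R - a%:~R * xi|))).
      by rewrite mulrA -AG; apply: ler_wpM2r => //; exact: ltW.
    by apply: ler_wpM2l; [exact: ltW | exact: le_trans apx (ltW Ldec)].
  move=> h; have {h} : 1 <= 5 * M * (A * L i).
    apply: le_trans h _; have := ler_wpM2l (ltW M_gt0) XA; lra.
  have M5 : 0 < 5 * M by rewrite mulr_gt0.
  by move=> /(ln_le_prod2 M5 A0 (L0 i)); have := Lk i; lra.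
have [j j4 /eqP] := minor2_neq0 mp (ltnSn i); apply.
have aj : a ^+ j != 0 by rewrite expf_neq0.
apply: (mulfI aj); rewrite mulr0.
have -> : a ^+ j * minor2 (x i) (x i.+1) 0 j =
  x i 0%N * (a ^+ j * x i.+1 j) - x i.+1 0%N * (a ^+ j * x i j) by rewrite /minor2; ring.
by rewrite (geometric_shift small) // (geometric_shift shift) //; ring.
Qed.

(** As [q] kills [x i], [q(xi)] is of order [h L_i / X_i], so for an earlier point the main term is
    absorbed by the error terms. *)
Lemma pairing_before q h i j e : coefs_le q h -> annihilates q (x i) -> (j < i)%N ->
  (e < 2)%N -> `|(pairing q (x j) e)%:~R : R| <= 6 * M * (h * L j).
Proof.
move=> qh [qx _] ji e2; have h0 := coefs_le_ge0 qh; have M1 := Mx_ge1 xi.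
have := pairing_bound qh (mp_errs mp j) e2; have := eval2_bound qh (mp_errs mp i) qx.
rewrite !(X_norm mp) => v p; apply: le_trans p _.
have hL : h * L i <= h * L j by apply: ler_wpM2l => //; apply/ltW/(L_mono mp).
have hL0 : 0 <= h * L j by rewrite mulr_ge0 // ltW.
have : X j * `|eval2 xi q| <= 3 * (h * L j).
  apply: le_trans (_ : X i * `|eval2 xi q| <= _); last by lra.
  by apply: ler_wpM2r => //; apply/ltW/(X_mono mp).
move=> /(ler_wpM2l (ltW M_gt0)) h2; nra.
Qed.

(** Here the main term rules: the quadratic form of [x i] has value of order [L_i^2] at [xi]. *)
Lemma pairing_after i j e : (i < j)%N -> (e < 2)%N ->
  `|(pairing (hankel (x i)) (x j) e)%:~R : R| <= 36 * M ^+ 2 * (X j * L i * L i).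
Proof.
move=> ij e2; have M1 := Mx_ge1 xi; have qh := coefs_le_hankel mp i.
have [qx _] := hankel_annihilates (x i).
have := pairing_bound qh (mp_errs mp j) e2; have := eval2_bound qh (mp_errs mp i) qx.
rewrite !(X_norm mp) => v p; apply: le_trans p _.
have {}v : `|eval2 xi (hankel (x i))| <= 18 * (M * (L i * L i)).
  by rewrite -(ler_pM2l (X0 i)); apply: le_trans v _;
    rewrite le_eqVlt; apply/orP; left; apply/eqP; ring.
have h1 : X j * `|eval2 xi (hankel (x i))| <= 18 * M * (X j * L i * L i).
  by apply: le_trans (ler_wpM2l (ltW (X0 j)) v) _;
    rewrite le_eqVlt; apply/orP; left; apply/eqP; ring.
have h2 : X i * L i * L j <= X j * L i * L i.
  have xx := X_mono mp ij; have ll := L_mono mp ij.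
  apply: ler_pM; rewrite ?mulr_ge0 ?(ltW (L0 _)) ?(ltW (X0 _)) ?(ltW ll) //.
  by apply: ler_wpM2r; rewrite ?(ltW (L0 _)) ?(ltW xx).
have P0 : 0 < X j * L i * L i by rewrite !mulr_gt0.
have := ler_wpM2l (ltW M_gt0) h1; have := ler_wpM2l (ltW M_gt0) h2.
have MP : M * (X j * L i * L i) <= M ^+ 2 * (X j * L i * L i).
  by rewrite expr2 -[M * M * _]mulrA ler_peMl // mulr_ge0 // ltW.
rewrite expr2 in MP *; lra.
Qed.

Lemma coefs_le_max (q : nat -> int) : exists h, coefs_le q h /\
  exists2 i, (i < 3)%N & `|(q i)%:~R : R| = h.
Proof.
pose h : R := Num.max `|(q 0%N)%:~R| (Num.max `|(q 1%N)%:~R| `|(q 2%N)%:~R|).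
exists h; split.
  by move=> [|[|[|//]]] _; rewrite /h !le_max lexx ?orbT.
rewrite /h; case: leP => _; last by exists 0%N.
by case: leP => _; [exists 2%N | exists 1%N].
Qed.

(* If q annihilates the consecutive points b = x_(i+1) and b' = x_(i+2) but not
   a = x_i, with q primitive of height h, then
   1 << h L_a, and X_b' L_b >< |b /\ b'| >< h^2 << (X_b L_b)^2 since b, b' is a
   basis of the integer points annihilated by q.  The bounds on L then force
   l^2 + 2 l <= 1. *)
Lemma annihilated_triple : 0 < l -> 1 < l ^+ 2 + 2 * l -> l < 1 / 2 ->
  exists N, forall i, (N <= i)%N -> annihilates (hankel (x i.+1)) (x i.+2) ->
    annihilates (hankel (x i.+1)) (x i).
Proof.
move=> l0 l2 lhalf; have l3 : 1 < 3 * l by nra.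
have M1 := Mx_ge1 xi.
have [N1 hN1] := hankel_nontrivial l3.
(* [432 M^3 = (6 M)^2 * 12 M] comes from squaring [hL] and inserting [hh]; [144 M^2 = 4 * (6 M)^2]
   comes from the upper bound for [h] in [lnX2]. *)
have [C1 C1_gt0 C1E] : exists2 C, 0 < C & C = 432 * M ^+ 3.
  by eexists; last reflexivity; have : 0 < M ^+ 3 := exprn_gt0 3 M_gt0; lra.
have [C2 C2_gt0 C2E] : exists2 C, 0 < C & C = 144 * M ^+ 2.
  by eexists; last reflexivity; have : 0 < M ^+ 2 := exprn_gt0 2 M_gt0; lra.
pose K1 := ln C1 + 3 * k.
pose K2 := ln C2 + k.
have [N2 hN2] := ln_X_large mp (((1 - l) * ln 2 + K1) / (3 * l - 1)).
have [N3 hN3] := ln_X_large mp (((1 - l) * K2 + (1 + l) * K1) / (2 * (l ^+ 2 + 2 * l - 1))).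
exists (maxn N1 (maxn N2 N3)) => i; rewrite !geq_max => /and3P[i1 i2 i3] Qb'.
apply: contrapT => Qa.
have {hN1}nz := hN1 i.+1 (leqW i1); move: (hN2 i.+1 (leqW i2)) (hN3 i.+1 (leqW i3)) => {hN2 hN3}.
rewrite ltr_pdivrMr; last lra.
rewrite ltr_pdivrMr; last lra.
set B := ln (X i.+1) => B2 B3.
have [q [u [g [g0 gq uq]]]] := primitive_part nz.
have down (y : nat -> int) : annihilates (hankel (x i.+1)) y <-> annihilates q y.
  have E e : pairing (hankel (x i.+1)) y e = g * pairing q y e.
    by rewrite /pairing !gq // !mulrDr !mulrA.
  rewrite /annihilates !E; split=> -[h1 h2]; last by rewrite h1 h2 mulr0.
  by split; apply: (mulfI g0); rewrite mulr0.
have qb := (down _).1 (hankel_annihilates (x i.+1)).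
move/down: Qb' => qb'; have {Qa}qa : ~ annihilates q (x i) by move/down.
have [h [qh [i0 i03 i0h]]] := coefs_le_max q.
have h0 := coefs_le_ge0 qh.
have hL : 1 <= 6 * M * (h * L i).
  have [e0|e0] := eqVneq (pairing q (x i) 0) 0; last first.
    exact: le_trans (intr_norm_ge1 R e0) (pairing_before (e := 0%N) qh qb (ltnSn i) isT).
  have [e1|e1] := eqVneq (pairing q (x i) 1) 0; first by case: qa.
  exact: le_trans (intr_norm_ge1 R e1) (pairing_before (e := 1%N) qh qb (ltnSn i) isT).
have hgt0 : 0 < h.
  rewrite lt_neqAle h0 andbT eq_sym; apply/negP => /eqP hz.
  by move: hL; rewrite hz mul0r mulr0; lra.
have [s sP] := plucker_rank1 qb qb' uq.
have L1 := ltW (mp_L_lt1 mp i.+1).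
have mb j j' : (j < 4)%N -> (j' < 4)%N ->
    `|(minor2 (x i.+1) (x i.+2) j j')%:~R : R| <= 6 * (M * (X i.+2 * L i.+1)).
  move=> hj hj'; apply: minor2_bound => //; rewrite ?(X_norm mp) ?(X_ge1 mp) //.
  - exact: mp_errs mp i.+1.
  - by move=> c c4; apply: le_trans (mp_errs mp i.+2 c4) _; exact/ltW/(mp_decr mp).
  - by apply/ltW/(X_mono mp).
have [[m01 m02 m03] [m12 m13 m23]] := minor2_plucker (x i.+1) (x i.+2).
have s0 : s != 0.
  apply: contraTneq isT => s0; have [j j4 /negP[]] := minor2_neq0 mp (ltnSn i.+1).
  by case: j j4 => [|[|[|[|//]]]] _; rewrite ?m01 ?m02 ?m03 ?sP // ?s0 ?mul0r ?oppr0 ?subr0 //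
    /minor2 mulrC subrr.
have sR : 1 <= `|s%:~R : R| := intr_norm_ge1 R s0.
(* The diagonal entry at the largest coefficient is at least [h^2]; the middle one is a sum of two
   minors, hence [12 = 2 * 6]. *)
have hh : h ^+ 2 <= 12 * (M * (X i.+2 * L i.+1)).
  have : h ^+ 2 <= `|(plucker (x i.+1) (x i.+2) i0 i0)%:~R : R|.
    rewrite sP // !intrM !normrM i0h -expr2 ler_peMl ?exprn_ge0 //.
  move=> /le_trans; apply.
  have ML0 : 0 < M * (X i.+2 * L i.+1) by rewrite !mulr_gt0.
  case: i0 i03 {i0h} => [|[|[|//]]] _; rewrite /plucker /=.
  - by apply: le_trans (mb 2%N 3%N _ _) _ => //; lra.
  - rewrite intrD; apply: le_trans (ler_normD _ _) _.
    by have := mb 0%N 3%N isT isT; have := mb 1%N 2%N isT isT; lra.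
  - by apply: le_trans (mb 0%N 1%N _ _) _ => //; lra.
have s1 : `|s| = 1.
  apply: (@primitive_pair _ _ _ _ mp i s s0).
  by apply: dvdz_minor2 => a b ha hb; rewrite sP // dvdz_mulr.
set B' := ln (X i.+2).
have lnX1 : 2 * l * B <= (1 - l) * B' + K1.
  have h2 : 1 <= C1 * (X i.+2 * L i.+1 * (L i * L i)).
    have : 1 * 1 <= (6 * M * (h * L i)) * (6 * M * (h * L i)) by apply: ler_pM.
    rewrite mulr1 => /le_trans; apply.
    have LM : 0 <= 36 * M ^+ 2 * (L i * L i) by rewrite !mulr_ge0 ?exprn_ge0 // ltW.
    by have := ler_wpM2l LM hh; rewrite C1E !exprS !expr0; lra.
  have := ln_le_prod3 C1_gt0 (X0 i.+2) (L0 i.+1) (mulr_gt0 (L0 i) (L0 i)) h2.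
  rewrite [ln (L i * L i)]lnM ?posrE //.
  by have := Lk i; have := Lk i.+1; rewrite -/B -/B' /K1; lra.
(* Otherwise [lnX1] bounds [(3 l - 1) B], contrary to the threshold [N2]. *)
have XX : 2 * X i.+1 <= X i.+2.
  rewrite leNgt; apply/negP; rewrite -ltr_ln ?posrE ?mulr_gt0 // lnM ?posrE // -/B -/B' => h2.
  nra.
have lnX2 : (1 + l) * B' <= 2 * B + K2.
  have [j j4 jE] := minor2_lower_half mp (ltnSn i.+1) XX.
  have qX : h <= 6 * (M * (X i.+1 * L i.+1)).
    rewrite -i0h; apply: le_trans (coefs_le_hankel mp i.+1 i03).
    by rewrite gq // intrM normrM ler_peMl // intr_norm_ge1.
  have mh : `|(minor2 (x i.+1) (x i.+2) 0 j)%:~R : R| <= 2 * h ^+ 2.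
    have sR1 : `|s%:~R : R| = 1 by rewrite -intr_norm s1.
    have qq a b : (a < 3)%N -> (b < 3)%N -> `|(s * (q a * q b))%:~R : R| <= h ^+ 2.
      by move=> a3 b3; rewrite !intrM normrM sR1 mul1r expr2; apply: normM_le; exact: qh.
    have hh0 : 0 <= h ^+ 2 by rewrite exprn_ge0.
    case: j j4 {jE} => [|[|[|[|//]]]] _.
    - by rewrite /minor2 mulrC subrr normr0; lra.
    - by rewrite m01 sP //; have := qq 2%N 2%N isT isT; lra.
    - by rewrite m02 sP // intrN normrN; have := qq 1%N 2%N isT isT; lra.
    - rewrite m03 !sP // intrB; apply: le_trans (ler_normB _ _) _.
      by have := qq 1%N 1%N isT isT; have := qq 0%N 2%N isT isT; lra.
  have h2 : X i.+2 <= C2 * (X i.+1 * X i.+1 * L i.+1).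
    rewrite -(ler_pM2r (L0 i.+1)).
    have : h ^+ 2 <= (6 * (M * (X i.+1 * L i.+1))) ^+ 2.
      by apply: lerXn2r => //; rewrite nnegrE // (le_trans h0 qX).
    by rewrite C2E !exprS !expr0 in mh *; lra.
  move: h2; rewrite -ler_ln ?posrE ?mulr_gt0 // !lnM ?posrE ?mulr_gt0 //.
  by have := Lk i.+1; rewrite -/B -/B' /K2; lra.
(* These weights eliminate [B'] and leave an upper bound for [2 (l^2 + 2 l - 1) B], contrary to
   [N3]. *)
have := ler_wpM2l (_ : 0 <= 1 + l) lnX1; have := ler_wpM2l (_ : 0 <= 1 - l) lnX2.
have p1 : 0 <= 1 + l by lra.
have p2 : 0 <= 1 - l by lra.
move=> /(_ p2) a1 /(_ p1) a2; nra.
Qed.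

Lemma log_det t p : (t < p)%N ->
  \det (\matrix_(i < 4) v (nth 0%N [:: t; p; p.+1; p.+2] i)) != 0 ->
  l * ln (X t.+1) + l * ln (X p.+1) <= (1 - l) * ln (X p.+2) + (ln 24 + 3 * k).
Proof.
move=> tp /(det_ge1 mp) h.
have {h} : 1 <= 24 * (X p.+2 * L t * L p * L p.+1).
  by apply: h; case=> [|[|[|[|//]]]] _ /=; lia.
move=> /ln_ge0; rewrite !lnM ?posrE ?mulr_gt0 //.
by have := Lk t; have := Lk p; have := Lk p.+1; lra.
Qed.

Lemma log_hankel p : ~ annihilates (hankel (x p.+1)) (x p) ->
  l * ln (X p.+2) <= (1 - l) * ln (X p.+1) + (ln (36 * M ^+ 2) + 2 * k).
Proof.
move=> na.
have M2 : 0 < 36 * M ^+ 2 by have := exprn_gt0 2 M_gt0; lra.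
have : 1 <= 36 * M ^+ 2 * (X p.+1 * L p.+1 * L p).
  have E e : (e < 2)%N -> pairing (hankel (x p.+1)) (x p) e != 0 ->
      1 <= 36 * M ^+ 2 * (X p.+1 * L p.+1 * L p).
    move=> e2 /(intr_norm_ge1 R) /le_trans; apply.
    apply: le_trans (pairing_before (coefs_le_hankel mp p.+1)
      (hankel_annihilates _) (ltnSn p) e2) _.
    by rewrite le_eqVlt; apply/orP; left; apply/eqP; ring.
  have [e0|] := eqVneq (pairing (hankel (x p.+1)) (x p) 0) 0; last exact: E.
  have [e1|] := eqVneq (pairing (hankel (x p.+1)) (x p) 1) 0; last exact: E.
  by case: na.
move: M2 => /[swap] h M2; have := ln_le_prod3 M2 (X0 p.+1) (L0 p.+1) (L0 p) h.
by have := Lk p; have := Lk p.+1; lra.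
Qed.

(** Since [x n] is in the span of [x i], [x i.+1] and [q] kills [x i], the pairs of [x n] and
    [x i.+1] with [q] are proportional. The pair [(a, b)] of [x i.+1] thus inherits the better
    approximation to [xi] coming from [L n], while its height is only of order [X_(i+1) L_i^2];
    [bad] limits this quality. *)
Lemma log_approx (w c : R) i n : 0 <= w -> l < 1 / 2 -> (i.+1 <= n)%N ->
  2 * X i <= X n -> (v n <= v i + v i.+1)%MS ->
  ~ annihilates (hankel (x i)) (x i.+1) ->
  (forall (a b : int) (V : R), (a != 0) || (b != 0) -> `|a%:~R| <= V -> `|b%:~R| <= V ->
    c <= ln `|b%:~R - a%:~R * xi| + w * ln V) ->
  l * ln (X n.+1) <= ln (X i) - l * ln (X n) + (1 - 2 * l) * w * ln (X n) +
    (ln (432 * M ^+ 3) + w * ln (36 * M ^+ 2) + 2 * k + 2 * w * k - c).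
Proof.
move=> w0 lhalf ilt x2 vn na bad.
have M2 : 0 < 36 * M ^+ 2 by have := exprn_gt0 2 M_gt0; lra.
have M3 : 0 < 432 * M ^+ 3 by have := exprn_gt0 3 M_gt0; lra.
pose q := hankel (x i); pose a := pairing q (x i.+1) 0; pose b := pairing q (x i.+1) 1.
have qh := coefs_le_hankel mp i; rewrite -/q in qh.
have ab : (a != 0) || (b != 0).
  by apply/negPn/negP; rewrite negb_or !negbK => /andP[/eqP a0 /eqP b0]; apply: na.
have [m [u [s [m0 xE]]]] := rat_row_comb vn.
have pE e : (e < 2)%N -> m * pairing q (x n) e = s * pairing q (x i.+1) e.
  move=> e2; have : pairing q (x i) e = 0.
    by have [? ?] := hankel_annihilates (x i); case: e e2 => [|[|//]].
  move=> z; transitivity (u * pairing q (x i) e + s * pairing q (x i.+1) e); last first.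
    by rewrite z mulr0 add0r.
  have e3 : (e.+2 < 4)%N by lia.
  rewrite /pairing !mulrDr !(mulrCA m) !xE //; [ring | lia | lia].
have mE j : (j < 4)%N -> m * minor2 (x i) (x n) 0 j = s * minor2 (x i) (x i.+1) 0 j.
  by move=> j4; rewrite /minor2 mulrBr !(mulrCA m) !xE //; ring.
have ilt' : (i < n)%N by [].
have [j j4 jE] := minor2_lower_half mp ilt' x2.
pose S := `|s%:~R : R|; pose T := `|m%:~R : R|.
have T0 : 0 < T by rewrite normr_gt0 intr_eq0.
(* The proportionality factor [m / s] is controlled by comparing the minors of [x i] with [x n] and
   with [x i.+1]. *)
have TS : T * X n <= 12 * M * (S * X i.+1).
  rewrite -(ler_pM2r (L0 i)) -[T * _ * _]mulrA.
  apply: le_trans (ler_wpM2l (ltW T0) jE) _; rewrite mulrCA /T -normrM -intrM mE // intrM normrM.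
  have mb : `|(minor2 (x i) (x i.+1) 0 j)%:~R : R| <= 6 * (M * (X i.+1 * L i)).
    apply: minor2_bound => //; rewrite ?(X_norm mp) ?(X_ge1 mp) ?(ltW (mp_L_lt1 mp i)) //.
    - exact: mp_errs mp i.
    - by move=> d d4; apply: le_trans (mp_errs mp i.+1 d4) _; exact/ltW/(mp_decr mp).
    - by apply/ltW/(X_mono mp).
  by have := ler_wpM2l (normr_ge0 (s%:~R : R)) mb; rewrite -/S; lra.
have S0 : 0 < S.
  rewrite lt_neqAle normr_ge0 andbT eq_sym; apply/negP => /eqP Sz; move: TS.
  by rewrite Sz mul0r mulr0 leNgt mulr_gt0.
set F := `|b%:~R - a%:~R * xi|.
have SF : S * F <= T * (36 * M ^+ 2 * (X i * L i * L n)).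
  have -> : S * F = T * `|(pairing q (x n) 1)%:~R - xi * (pairing q (x n) 0)%:~R|.
    rewrite /S /T /F -!normrM; congr `|_|; rewrite !mulrBr !mulrA -!intrM.
    by rewrite -(pE 1%N) // -(pE 0%N) // mulrAC !intrM; ring.
  apply: ler_wpM2l; first exact: ltW.
  apply: le_trans (pairing_approx qh (mp_errs mp n)) _.
  by rewrite le_eqVlt; apply/orP; left; apply/eqP; ring.
have FX : F * X n <= 432 * M ^+ 3 * (X i * L i * L n * X i.+1).
  rewrite -(ler_pM2l S0) [S * (F * _)]mulrA; apply: le_trans (ler_wpM2r (ltW (X0 n)) SF) _.
  have P0 : 0 <= 36 * M ^+ 2 * (X i * L i * L n) by rewrite !mulr_ge0 ?(ltW M2) // ltW.
  have := ler_wpM2l P0 TS; rewrite !exprS !expr0; lra.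
have F0 : 0 < F.
  rewrite normr_gt0; apply/negP => /eqP; rewrite -mulNr -intrN.
  move=> /(transcendental_irrational hxi)[b0 /eqP]; rewrite oppr_eq0 => a0.
  by move: ab; rewrite b0 a0 eqxx.
pose V := 36 * M ^+ 2 * (X i.+1 * L i * L i).
have aV : `|a%:~R : R| <= V by apply: pairing_after.
have bV : `|b%:~R : R| <= V by apply: pairing_after.
have := bad a b V ab aV bV; rewrite -/F.
have XX : ln (X i.+1) <= ln (X n).
  rewrite ler_ln ?posrE //; move: ilt; rewrite leq_eqVlt => /orP[/eqP -> //|h].
  exact/ltW/(X_mono mp).
have -> : ln V = ln (36 * M ^+ 2) + ln (X i.+1) + ln (L i) + ln (L i) by exact: ln_prod3.
have : ln F + ln (X n) <=
    ln (432 * M ^+ 3) + ln (X i * L i) + ln (L n) + ln (X i.+1).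
  move: (432 * M ^+ 3) M3 FX => K3 M3 FX.
  by rewrite -lnM ?posrE // -ln_prod3 ?mulr_gt0 // ler_ln ?posrE ?mulr_gt0.
rewrite [ln (X i * L i)]lnM ?posrE //.
move: (Lk i) (Lk n) XX; clear -w0 lhalf.
move: (ln (X i.+1)) (ln (X n)) (ln (X n.+1)) (ln (X i)) (ln (L i)) (ln (L n)) (ln F).
move: (ln (432 * M ^+ 3)) (ln (36 * M ^+ 2)) => c1 c2 B' C D B Li Ln f a1 a2 a3 a4 a5.
have w1 : 0 <= 1 + 2 * w by lra.
(* This is the coefficient of [ln (X i.+1)] once [L i] is eliminated; being nonnegative, it allows
   [X i.+1] to be replaced by [X n]. *)
have w2 : 0 <= 1 - l + w * (1 - 2 * l) by rewrite addr_ge0 ?mulr_ge0 //; lra.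
by have := ler_wpM2l w1 a1; have := ler_wpM2l w2 a3; lra.
Qed.

Lemma exponent_bound (w c : R) : 0 < l -> 1 < l ^+ 2 + 2 * l -> l < 1 / 2 -> 0 <= w ->
  (forall (a b : int) (V : R), (a != 0) || (b != 0) -> `|a%:~R| <= V -> `|b%:~R| <= V ->
    c <= ln `|b%:~R - a%:~R * xi| + w * ln V) ->
  l ^+ 2 + 2 * l - 1 <= l ^+ 2 * (1 - 2 * l) * w.
Proof.
move=> l0 l2 lhalf w0 bad; rewrite leNgt; apply/negP => wlt.
have l3 : 1 < 3 * l by nra.
have [N1 hN1] := hankel_nontrivial l3.
have [N2 hN2] := annihilated_triple l0 l2 lhalf.
pose K1 := ln 24 + 3 * k; pose K4 := ln (36 * M ^+ 2) + 2 * k.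
pose K5 := ln (432 * M ^+ 3) + w * ln (36 * M ^+ 2) + 2 * k + 2 * w * k - c.
have d0 : 0 < l ^+ 2 + 2 * l - 1 by lra.
(* The coefficient of [C] in [log_final], positive under the assumption to be refuted. [N3] will
   serve for [X_b] in [log_gap], [N4] for [X_c] in [log_final]. *)
pose d := (1 - l) * (l ^+ 2 + 2 * l - 1 - l ^+ 2 * (1 - 2 * l) * w).
have dgt0 : 0 < d by apply: mulr_gt0; lra.
have [N3 hN3] := ln_X_large mp
  (((1 - 2 * l) * ln 2 + (l * K1 + (1 - l) * K4)) / (l ^+ 2 + 2 * l - 1)).
have [N4 hN4] := ln_X_large mp
  (((1 - l - l ^+ 2) * (l * K1 + (1 - l) * K4) + l ^+ 2 * (l * K1 + (1 - l) * K5)) / d).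
have [t [p]] := exists_quadruple (rank_consecutive mp) (no_linear_relation mp hxi)
  (maxn (maxn N1 N2) (maxn N3 N4)).
rewrite !geq_max => -[/andP[/andP[t1 t2] /andP[t3 t4]] tp bc cb det0].
have lnlt i j : (i < j)%N -> ln (X i) <= ln (X j).
  by move=> ij; rewrite ler_ln ?posrE //; exact/ltW/(X_mono mp).
have {hN3} := hN3 _ (leqW t3); rewrite ltr_pdivrMr // => B3.
have {hN4} := hN4 p.+1 (leq_trans t4 (leqW (ltnW tp))); rewrite ltr_pdivrMr // => C4.
have h1 := log_det tp det0.
have vb : (v t.+1 <= v p + v p.+1)%MS := submx_trans (addsmxSl _ _) bc.
have vb' : (v t.+2 <= v p + v p.+1)%MS := submx_trans (addsmxSr _ _) bc.
have vc' : (v p <= v t.+1 + v t.+2)%MS := submx_trans (addsmxSl _ _) cb.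
have vc : (v p.+1 <= v t.+1 + v t.+2)%MS := submx_trans (addsmxSr _ _) cb.
have in_span q i j n : (v n <= v i + v j)%MS -> annihilates q (x i) -> annihilates q (x j) ->
    annihilates q (x n).
  by move=> /rat_row_comb[m [u [s [m0 xE]]]]; exact: annihilates_comb m0 xE.
(* Otherwise the form of [b] also kills [x t], by [annihilated_triple], and [c'], [c], by the common
   plane: three rows of a nonzero determinant. *)
have nab : ~ annihilates (hankel (x t.+1)) (x t.+2).
  move=> qb'; have qa := hN2 t t2 qb'; have qb := hankel_annihilates (x t.+1).
  have qc' := in_span _ _ _ _ vc' qb qb'; have qc := in_span _ _ _ _ vc qb qb'.
  case/eqP: det0; apply: (@annihilated_det (hankel (x t.+1))
    (fun i => x (nth 0%N [:: t; p; p.+1; p.+2] i))); first exact: hN1 (leqW t1).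
  by apply: lt3P.
(* Otherwise the form of [c] kills [b] and [b'], so it is proportional to that of [b], which would
   then kill [b']. *)
have nac : ~ annihilates (hankel (x p.+1)) (x p).
  move=> qc'; have qc := hankel_annihilates (x p.+1).
  have qb := in_span _ _ _ _ vb qc' qc; have qb' := in_span _ _ _ _ vb' qc' qc.
  have prop := annihilates_prop qb.
  have nz := hN1 p.+1 (leq_trans t1 (leqW (ltnW tp))).
  have zero e : pairing (hankel (x p.+1)) (x t.+2) e = 0 ->
      pairing (hankel (x t.+1)) (x t.+2) e = 0.
    move=> z; apply: contrapT => /eqP nze; apply: nz.
    have E i : (i < 3)%N -> hankel (x p.+1) i = 0.
      move=> i3; apply: (mulIf nze); rewrite mul0r.
      transitivity (hankel (x t.+1) i * pairing (hankel (x p.+1)) (x t.+2) e).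
        rewrite /pairing !mulrDr !mulrA (prop i 0%N) // (prop i 1%N) // (prop i 2%N) //.
        by rewrite ![hankel (x t.+1) i * _]mulrC.
      by rewrite z mulr0.
    by split; exact: E.
  by apply: nab; case: qb' => z0 z1; split; exact: zero.
have h4 := log_hankel nac.
have X2 : 2 * X t.+1 <= X p.+1.
  rewrite leNgt; apply/negP; rewrite -ltr_ln ?posrE ?mulr_gt0 // lnM ?posrE // => lt2.
  have := log_gap l0 lhalf h1 h4; rewrite -/K1 -/K4 => gap.
  have p1 : 0 <= 1 - 2 * l by lra.
  by have := ler_wpM2l p1 (ltW lt2); lra.
have h5 := log_approx w0 lhalf (tp : (t.+1 < p.+1)%N) X2 vc nab bad.
by have := log_final l0 lhalf h1 h4 h5; rewrite -/K1 -/K4 -/K5 -/d; lra.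
Qed.

End Exponent.

(** * The two exponents *)

Section Final.
Context {R : realType} (xi : R).
Hypothesis hxi : transcendental xi.

Definition linear_approx (w : R) := forall M : R, exists Q : R, M <= Q /\
  exists P : {poly int}, [/\ (size P <= 2)%N, (height P)%:R <= Q &
    0 < `|(map_poly intr P).[xi]| <= Q `^ (- w)].

Lemma horner_linear (P : {poly int}) : (size P <= 2)%N ->
  (map_poly intr P).[xi] = (P`_0)%:~R + (P`_1)%:~R * xi :> R.
Proof.
move=> P2; rewrite (@horner_coef_wide _ 2).
  by rewrite !big_ord_recl big_ord0 !coef_map /= expr0 expr1 mulr1 addr0.
by apply: leq_trans P2; exact: size_poly.
Qed.

Lemma coef_height (P : {poly int}) i : (absz (P`_i)%R <= height P)%N.
Proof.
have [iP|Pi] := ltnP i (size P); last by rewrite nth_default.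
exact: (@leq_bigmax _ (fun i : 'I_(size P) => absz (P`_i)%R) (Ordinal iP)).
Qed.

Lemma height_linear (a b : int) (Q : R) : `|a%:~R : R| <= Q -> `|b%:~R : R| <= Q ->
  let P := b%:P - a *: 'X in
  [/\ (size P <= 2)%N, (height P)%:R <= Q & (map_poly intr P).[xi] = b%:~R - a%:~R * xi].
Proof.
move=> aQ bQ P.
have c0 : P`_0 = b by rewrite coefB coefC coefZ coefX /= mulr0 subr0.
have c1 : P`_1 = - a by rewrite coefB coefC coefZ coefX /= mulr1 sub0r.
have P2 : (size P <= 2)%N.
  apply: leq_trans (size_polyD _ _) _; rewrite geq_max size_polyN.
  by rewrite (leq_trans (size_polyC_leq1 _)) //= (leq_trans (size_scale_leq _ _)) // size_polyX.
split=> //; last by rewrite horner_linear // c0 c1 intrN mulNr.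
have cQ i : (i < 2)%N -> (absz P`_i)%:R <= Q.
  by case: i => [|[|//]] _; rewrite ?c0 ?c1 ?abszN; [move: bQ|move: aQ];
    rewrite -intr_norm -abszE pmulrn.
have Q0 : 0 <= Q by exact: le_trans aQ.
rewrite /height; elim/big_ind: _ => [|m n mQ nQ|i _] //.
  by rewrite /maxn; case: ifP.
by apply: cQ; exact: leq_trans (ltn_ord i) P2.
Qed.

Lemma linear_neq0 (a b : int) : (a != 0) || (b != 0) -> 0 < `|b%:~R - a%:~R * xi|.
Proof.
move=> ab; rewrite normr_gt0; apply/negP => /eqP; rewrite -mulNr -intrN.
by move=> /(transcendental_irrational hxi)[b0 /eqP]; move: ab;
  rewrite oppr_eq0 b0 eqxx orbF => /negPf ->.
Qed.

(** Taking [Q = M' V] puts every height bound [V >= 1] beyond the threshold, at the price of the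
    constant [- w * ln M']. *)
Lemma not_linear_approx (w : R) : 0 <= w -> ~ linear_approx w ->
  exists c, forall (a b : int) (V : R), (a != 0) || (b != 0) -> `|a%:~R| <= V -> `|b%:~R| <= V ->
    c <= ln `|b%:~R - a%:~R * xi| + w * ln V.
Proof.
move=> w0 nw.
have [M hM] : exists M, forall Q, M <= Q -> ~ exists P : {poly int},
    [/\ (size P <= 2)%N, (height P)%:R <= Q & 0 < `|(map_poly intr P).[xi]| <= Q `^ (- w)].
  apply: contrapT => h; apply: nw => M; apply: contrapT => h'; apply: h; exists M => Q MQ hQ.
  by apply: h'; exists Q.
pose M' := Num.max M 1; have M1 : 1 <= M' by rewrite le_max lexx orbT.
exists (- w * ln M') => a b V ab aV bV.
have V1 : 1 <= V.
  by case/orP: ab => /(intr_norm_ge1 R) h; [exact: le_trans h aV|exact: le_trans h bV].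
have V0 : 0 < V by lra.
have M0 : 0 < M' by lra.
have VM : V <= M' * V by rewrite ler_peMl // ltW.
have MV : M <= M' * V.
  apply: (@le_trans _ _ M'); first by rewrite le_max lexx.
  by rewrite ler_peMr // ltW.
have F0 := linear_neq0 ab.
have [P2 Ph PE] := height_linear (le_trans aV VM) (le_trans bV VM).
have := hM _ MV; rewrite leNgt => h; apply/negP => lt; apply: h.
eexists; split; [exact: P2 | exact: Ph |]; rewrite PE F0 /=.
rewrite -ler_ln ?posrE ?powR_gt0 ?mulr_gt0 // ln_powR lnM ?posrE //; lra.
Qed.

(* At Q a real number for which b - a xi is < Q^(-4), both summands of the
   value of the shifted form at the minimal point with X_i < Q^(7/2) <= X_(i+1)
   are < 1/2. *)
Lemma uniform_le_third (w l : R) : 4 <= w -> linear_approx w -> uniform xi l -> l <= 1 / 3.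
Proof.
move=> w4 hw ul; rewrite leNgt; apply/negP => l3.
have l3' : 1 < 3 * l by lra.
have [|x [L [k [mp Lk]]]] := exists_minimal_points hxi _ ul; first lra.
have [N hN] := hankel_nontrivial mp Lk l3'.
pose m := ln (Mx xi); pose A := (2 * ln 2 + k) / (7 / 2 * l - 1).
(* The first two terms make the selected index at least [N]; the others give [s1], which uses
   [7/2 < 4], and [s2], which uses [7/2 * l > 1]. *)
pose B := Num.max (Num.max 1 (ln (x N 0%N)%:~R)) (Num.max (2 * (m + ln 2) + 1) (A + 1)).
have [Q [BQ [P [P2 PQ /andP[F0 FQ]]]]] := hw (expR B).
have Q0 : 0 < Q := lt_le_trans (expR_gt0 B) BQ.
have : B <= ln Q by rewrite -[leLHS]expRK ler_ln ?posrE ?expR_gt0.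
rewrite !ge_max; set q := ln Q => /andP[/andP[q1 qN] /andP[qm qA]].
have {qA} : 2 * ln 2 + k < q * (7 / 2 * l - 1).
  by rewrite -ltr_pdivrMr; [rewrite -/A; lra | lra].
move=> qA.
pose b := P`_0; pose a := - P`_1.
rewrite horner_linear // -[P`_1]opprK -/a -/b intrN mulNr in F0 FQ.
have aQ : `|a%:~R : R| <= Q.
  by rewrite -intr_norm -abszE -pmulrn abszN; apply: le_trans PQ; rewrite ler_nat coef_height.
have bQ : `|b%:~R : R| <= Q.
  by rewrite -intr_norm -abszE -pmulrn; apply: le_trans PQ; rewrite ler_nat coef_height.
have [N' hN'] := ln_X_large mp (7 / 2 * q).
have ex : exists i, ln (x i 0%N)%:~R < 7 / 2 * q by exists N; lra.
have bnd i : ln (x i 0%N)%:~R < 7 / 2 * q -> (i <= N')%N.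
  by apply: contraLR; rewrite -ltnNge -leNgt => /ltnW /hN' /ltW.
case: (ex_maxnP ex bnd) => i iq imax.
have Ni : (N <= i)%N by apply: imax; lra.
have iq' : 7 / 2 * q <= ln (x i.+1 0%N)%:~R.
  by rewrite leNgt; apply/negP => /imax; rewrite ltnn.
have X0 := X_gt0 mp i; have L0 := L_gt0 mp i; have M0 := Mx_gt0 xi.
apply: (hN i Ni); apply: (shift_hankel_trivial mp (a := a) (b := b)).
  apply/negPn/negP; rewrite negb_or !negbK => /andP[/eqP a0 /eqP b0].
  by move: F0; rewrite a0 b0 mul0r subrr normr0 ltxx.
move=> j j3; apply: subr0_eq; apply/eqP/negPn/negP => nz.
have := le_trans (intr_norm_ge1 R nz) (shift_bound mp i j3 aQ bQ).
set F := `|b%:~R - a%:~R * xi| in F0 FQ *.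
have lnF : ln F <= - (4 * q).
  have h : ln F <= ln (Q `^ (- w)) by rewrite ler_ln ?posrE ?powR_gt0.
  by apply: le_trans h _; rewrite ln_powR -/q; nra.
have s1 : Mx xi * ((x i 0%N)%:~R * F) < 2^-1.
  rewrite -ltr_ln ?posrE ?mulr_gt0 ?invr_gt0 // lnV ?posrE //.
  by rewrite lnM ?posrE ?mulr_gt0 // [ln (_ * F)]lnM ?posrE // -/m; lra.
have s2 : 2 * (Q * L i) < 2^-1.
  rewrite -ltr_ln ?posrE ?mulr_gt0 ?invr_gt0 // !lnM ?posrE ?mulr_gt0 // lnV ?posrE // -/q.
  have l0 : 0 <= l by lra.
  by have := Lk i; have := ler_wpM2l l0 iq'; lra.
lra.
Qed.

(** The polynomial [T - floor xi] has value in [(0, 1)]; this yields [omega 1 xi >= 0]. *)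
Lemma linear_approx0 : linear_approx 0.
Proof.
move=> M; pose z := Num.floor xi; pose Q := Num.max M (Num.max 1 `|(- z)%:~R|).
exists Q; split; first by rewrite le_max lexx.
have aQ : `|(-1)%:~R : R| <= Q by rewrite normrN normr1 !le_max lexx orbT.
have bQ : `|(- z)%:~R : R| <= Q by rewrite !le_max lexx !orbT.
have [P2 Ph PE] := height_linear aQ bQ; eexists; split; [exact: P2|exact: Ph|].
rewrite PE oppr0 powRr0 linear_neq0 //=.
have := floor_itv xi; rewrite -/z intrD => /andP[h1 h2].
by rewrite !intrN mulN1r opprK ler_norml; apply/andP; lra.
Qed.

Lemma uniform0 : uniform xi 0.
Proof.
exists 1 => Q Q1; exists (fun j : 'I_4 => if j == ord0 then 1 else Num.floor (xi ^+ j)).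
split; first by rewrite /= normr1 lexx ltW.
rewrite oppr0 powRr0; apply: bigmax_lt => // i i0.
have /negPf -> : i != ord0 by rewrite -lt0n.
have := floor_itv (xi ^+ i); rewrite /= mul1r intrD => /andP[h1 h2].
by rewrite ger0_norm; lra.
Qed.

Lemma uniform_le (l l' : R) : l' <= l -> uniform xi l -> uniform xi l'.
Proof.
move=> ll [M hM]; exists (Num.max M 1) => Q; rewrite gt_max => /andP[MQ Q1].
have [x [x1 x2]] := hM Q MQ; exists x; split=> //; apply: lt_le_trans x2 _.
by apply: ler_powR; [exact: ltW | rewrite lerN2].
Qed.

Lemma uniform_bound (W l : R) : 0 <= W -> (forall w, W < w -> ~ linear_approx w) ->
  0 <= l -> l < 1 / 2 -> uniform xi l ->
  l ^+ 2 + 2 * l - 1 <= l ^+ 2 * (1 - 2 * l) * W.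
Proof.
move=> W0 hW l0 lhalf ul.
have c0 : 0 <= l ^+ 2 * (1 - 2 * l) by rewrite mulr_ge0 ?exprn_ge0 //; lra.
have [l2|l2] := leP (l ^+ 2 + 2 * l) 1.
  by apply: (@le_trans _ _ 0); [lra | exact: mulr_ge0].
apply/ler_addgt0Pr => e e0.
have lgt0 : 0 < l by nra.
have [x [L [k [mp Lk]]]] := exists_minimal_points hxi lgt0 ul.
have wW : 0 <= W + e by lra.
have [|c hc] := not_linear_approx wW (hW (W + e) _); first lra.
have := exponent_bound mp hxi Lk lgt0 l2 lhalf wW hc.
have c1 : l ^+ 2 * (1 - 2 * l) <= 1 by nra.
by move=> /le_trans; apply; have := ler_wpM2r (ltW e0) c1; lra.
Qed.

(** Continuity in [l], needed because the supremum may not be attained. Moving by [d] changes the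
    left side by at most [3 d] and lowers the right side by at most [d * W / 2], whence [C]. *)
Lemma bound_closed (W l : R) : 0 <= W -> 0 < l -> l <= 1 / 2 ->
  (forall l', 0 <= l' -> l' < l -> l' ^+ 2 + 2 * l' - 1 <= l' ^+ 2 * (1 - 2 * l') * W) ->
  l ^+ 2 + 2 * l - 1 <= l ^+ 2 * (1 - 2 * l) * W.
Proof.
move=> W0 l0 lhalf h; apply/ler_addgt0Pr => e e0.
pose C := W / 2 + 3; have C0 : 0 < C by rewrite /C; lra.
pose d := Num.min l (e / C).
have d0 : 0 < d by rewrite lt_min l0 divr_gt0.
have dl : d <= l by rewrite ge_min lexx.
have dC : d * C <= e by rewrite -ler_pdivlMr // ge_min lexx orbT.
pose l' := l - d; have l'0 : 0 <= l' by rewrite subr_ge0.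
have hl' := h l' l'0; have {}hl' := hl' ltac:(rewrite /l'; lra).
have l'l : l' <= l by rewrite /l'; lra.
have k1 : - (1 / 2) <= (l + l') - 2 * (l ^+ 2 + l * l' + l' ^+ 2) by nra.
have k2 : l + l' + 2 <= 3 by lra.
have dW : 0 <= d * W by rewrite mulr_ge0 // ltW.
have := ler_wpM2l dW k1; have := ler_wpM2l (ltW d0) k2.
have -> : l' = l - d by [].
rewrite /C in dC; rewrite /l' in hl'; lra.
Qed.

End Final.

Lemma lambda_hat3E (R : realType) (xi : R) :
  lambda_hat 3 xi = ereal_sup (EFin @` [set l | uniform xi l]).
Proof.
rewrite /lambda_hat; congr (ereal_sup (_ @` _)); apply/seteqP; split=> l /=.
  by case=> M [_ hM]; exists M.
by case=> M hM; exists M; split=> //; exact: num_real.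
Qed.

Lemma omega1E (R : realType) (xi : R) :
  omega 1 xi = ereal_sup (EFin @` [set w | linear_approx xi w]).
Proof. by []. Qed.

Lemma lambda_hat3_sup (R : realType) (xi b : R) : (forall l, uniform xi l -> l <= b) ->
  exists l, [/\ lambda_hat 3 xi = l%:E, 0 <= l, l <= b &
    forall l', l' < l -> uniform xi l'].
Proof.
move=> ub; pose U := [set l | uniform xi l].
have U0 : U !=set0 by exists 0; exact: uniform0.
have hub : has_ubound U by exists b => l /ub.
exists (sup U); split.
- by rewrite lambda_hat3E ereal_sup_EFin.
- by apply: (ub_le_sup hub); exact: uniform0.
- by apply: ge_sup => // l /ub.
- by move=> l' /(sup_gt U0)[l'' ul'' /ltW ll]; exact: uniform_le ll ul''.
Qed.

(* omega 1 xi = +oo (Liouville numbers): the inequality is read as its limit,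
   i.e. it holds for all sufficiently large real values w of the exponent. *)
Theorem theorem3 (R : realType) (xi : R) (hxi : transcendental xi) :
  exists l : R, lambda_hat 3 xi = l%:E /\
    let F (w : R) := 2 * l ^+ 3 * w - l ^+ 2 * (w - 1) + 2 * l in
    match omega 1 xi with
    | w%:E => F w <= 1
    | +oo%E => \forall w \near +oo, F w <= 1
    | -oo%E => False
    end.
Proof.
have om0 : (0%:E <= omega 1 xi)%E.
  by rewrite omega1E; apply: ereal_sup_ubound; exists 0 => //; exact: linear_approx0.
case E : (omega 1 xi) om0 => [W| |] //; rewrite ?lee_fin => W0; last first.
  (* An admissible exponent above 4 gives [l <= 1/3]. Then [l^2 + 2 l < 1] and the coefficient of
     [y] in [F y] is at most 0. *)
  have [_ [w hw <-] w4] : exists2 y, (EFin @` [set w | linear_approx xi w]) y & (4%:E < y)%E.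
    by apply: ereal_sup_gt; rewrite -omega1E E ltry.
  have {}w4 : 4 <= w by apply/ltW; rewrite -lte_fin.
  have [l [lE l0 l3 _]] := lambda_hat3_sup (fun l => uniform_le_third hxi w4 hw (l := l)).
  exists l; split=> //=; exists 0; split=> // y y0.
  have c0 : 0 <= l ^+ 2 * (1 - 2 * l) * y by rewrite !mulr_ge0 ?exprn_ge0 ?(ltW y0) //; lra.
  have : l ^+ 2 + 2 * l <= 1 by nra.
  lra.
have hW w : W < w -> ~ linear_approx xi w.
  move=> Ww hw; have : (w%:E <= omega 1 xi)%E.
    by rewrite omega1E; apply: ereal_sup_ubound; exists w.
  by rewrite E lee_fin leNgt Ww.
(* At [1/2] the factor [1 - 2 l] removes [W], and the bound would read [1/4 <= 0]. *)
have half l : uniform xi l -> l <= 1 / 2.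
  move=> ul; rewrite leNgt; apply/negP => lhalf.
  have : (1 / 2 : R) ^+ 2 + 2 * (1 / 2) - 1 <= (1 / 2) ^+ 2 * (1 - 2 * (1 / 2)) * W.
    apply: bound_closed => // l' l'0 l'half.
    apply: (uniform_bound hxi W0 hW) => //; exact: uniform_le (ltW (lt_trans l'half lhalf)) ul.
  have -> : 1 - 2 * (1 / 2) = 0 :> R by lra.
  by rewrite mulr0 mul0r; lra.
have [l [lE l0 lhalf ul]] := lambda_hat3_sup half.
exists l; split=> //=.
have [->|lpos] := eqVneq l 0; first by rewrite !expr0n /=; lra.
have {}lpos : 0 < l by rewrite lt_neqAle eq_sym lpos.
have : l ^+ 2 + 2 * l - 1 <= l ^+ 2 * (1 - 2 * l) * W.
  apply: bound_closed => // l' l'0 l'l.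
  by apply: (uniform_bound hxi W0 hW) => //; [lra | exact: ul].
lra.
Qed.
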